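(* For every real $C>1$ there exists a constant $\varepsilon>0$ such that for all sufficiently large positive integers $\ell$, \[R(\ell, C\ell)\geq \big(p_C^{-1/2}+\varepsilon\big)^\ell,\] where $p_C\in(0,1/2)$ is the unique solution of the equation $C=\frac{\log p_C}{\log(1-p_C)}$.
   Context: For positive integers $\ell,k$, the Ramsey number $R(\ell,k)$ is the smallest integer $n$ such that every red/blue colouring of the edges of the complete graph $K_n$ contains either a red copy of $K_\ell$ (all edges red) or a blue copy of $K_k$ (all edges blue). In the statement $C\ell$ is used as the second argument of $R$, as printed in the paper. *)

(* Defs.v *)
From HB Require Import structures.
From mathcomp Require Import all_boot all_order all_algebra.
From mathcomp Require Import boolp.
Set Implicit Arguments. Unset Strict Implicit. Unset Printing Implicit Defensive.

(* A red/blue colouring of the edges of K_n on vertex set 'I_n: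
   the edge {i,j} with i < j gets colour c i j (true = red, false = blue);
   values c i j with i >= j are irrelevant. *)
Definition colouring (n : nat) := 'I_n -> 'I_n -> bool.

Definition mono_clique n (c : colouring n) (b : bool) (S : {set 'I_n}) : Prop :=
  forall i j : 'I_n, i \in S -> j \in S -> (i < j)%N -> c i j = b.

Definition ramsey_prop (l k n : nat) : Prop :=
  forall c : colouring n, exists S : {set 'I_n},
    (#|S| = l /\ mono_clique c true S) \/ (#|S| = k /\ mono_clique c false S).

(* R(l,k): the smallest n with ramsey_prop l k n (this always exists by
   Ramsey's theorem; the fallback value 0 is never used). *)
Definition ramsey (l k : nat) : nat :=
  match pselect (exists n, `[< ramsey_prop l k n >]) with
  | left H => ex_minn H
  | right _ => 0
  end.

(* Main.v *)
Require Import Defs.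
From HB Require Import structures.
From mathcomp Require Import all_boot all_order all_algebra.
From mathcomp Require Import all_classical all_reals all_analysis.
From mathcomp Require Import ring lra zify.
Import Order.TTheory GRing.Theory Num.Theory.
Local Open Scope ring_scope.

(** Attach to every vertex a uniformly random sign vector in dimension [D ^ 2],
with [D] proportional to [l], and let [s] be the inner product of two of them,
scaled to variance one.  An edge is red with the logistic probability
[p e^(-q h s) / F s] and blue with probability [q e^(p h s) / F s], where
[q = 1 - p], [F s = p e^(-q h s) + q e^(p h s) >= 1] and [h] is a small constant.

For a set of [m] vertices the product of the factors [e^(-q h s)] has an exactly
controllable mean: the coordinates are independent and
[E e^(- lam S^2) <= (1 + 2 m lam)^(-1/2) e^(4 m lam^2)] for a sum [S] of [m]
signs.  With [th = q h m / D] this contributes, besides the second-order term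
[th^2 / 4] of independent edges, the triangle term [- th^3 / 6] in each of the
[D ^ 2] coordinates, which helps the red cliques; the blue cliques suffer the
opposite term.  Moving [p] slightly away from the critical density redistributes
the two effects, and the balance is favourable exactly because
[C p^2 < (1 - p)^2] for [p < 1/2].

It remains to see that the factors [1 / F s] behave as for independent edges.
By Hoelder they may be averaged separately, raised to a large power, and [ln F]
dominates a multiple of [- ln (1 - z (1 - cos (z s)))].  The vertices are cut
into [w] groups, and a round-robin tournament of the groups writes the pairs as
[w] rounds of vertex-disjoint blocks; Hoelder again reduces to one round, hence
to one block.  In a block the product of the cosines is a Fourier average, and
its mean is bounded by a second and fourth moment computation for a bilinear
form in random signs, which is sharp because a block is small compared to the
dimension. *)

(** * Averages over uniformly random bits: shifts, independence and Hoelder *)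

Section SignAverages.
Variable R : realType.

(* Average over a uniformly random family of bits; the bit [b] stands for the
   sign [(-1) ^+ b]. *)
Definition bitavg (K : finType) (f : {ffun K -> bool} -> R) : R :=
  2^-1 ^+ #|K| * \sum_x f x.

Definition bitxor (K : finType) (x y : {ffun K -> bool}) : {ffun K -> bool} :=
  [ffun k => x k (+) y k].

Definition restr (K K' : finType) (g : K' -> K) (x : {ffun K -> bool}) :
  {ffun K' -> bool} := [ffun k => x (g k)].

(** Bits off the image of [g] are [false], so that [bitxor] with an extended vector changes only the
    bits on that image. *)
Definition extend (K K' : finType) (g : K' -> K) (y : {ffun K' -> bool}) :
  {ffun K -> bool} := [ffun k => if [pick k' | g k' == k] is Some k' then y k' else false].

Section Basics.
Variable K : finType.
Implicit Types f g : {ffun K -> bool} -> R.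

Lemma bitavg_scale_ge0 : 0 <= 2^-1 ^+ #|K| :> R.
Proof. by rewrite exprn_ge0// invr_ge0. Qed.

Lemma eq_bitavg f g : f =1 g -> bitavg K f = bitavg K g.
Proof. by move=> fg; rewrite /bitavg; under eq_bigr do rewrite fg. Qed.

Lemma bitavgD f g : bitavg K (fun x => f x + g x) = bitavg K f + bitavg K g.
Proof. by rewrite /bitavg big_split mulrDr. Qed.

Lemma bitavgZ c f : bitavg K (fun x => c * f x) = c * bitavg K f.
Proof. by rewrite /bitavg -mulr_sumr mulrCA. Qed.

Lemma bitavg_sum (I : Type) (r : seq I) (P : pred I) (f : I -> {ffun K -> bool} -> R) :
  bitavg K (fun x => \sum_(i <- r | P i) f i x) = \sum_(i <- r | P i) bitavg K (f i).
Proof. by rewrite /bitavg exchange_big mulr_sumr. Qed.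

Lemma bitavg_cst c : bitavg K (fun=> c) = c.
Proof.
rewrite /bitavg sumr_const card_ffun card_bool -[c *+ _]mulr_natl natrX mulrA -exprMn.
by rewrite mulVf ?pnatr_eq0// expr1n mul1r.
Qed.

Lemma bitavg_le f g : (forall x, f x <= g x) -> bitavg K f <= bitavg K g.
Proof. by move=> fg; rewrite ler_wpM2l ?bitavg_scale_ge0// ler_sum. Qed.

Lemma bitavg_ge0 f : (forall x, 0 <= f x) -> 0 <= bitavg K f.
Proof. by move=> f0; rewrite mulr_ge0 ?bitavg_scale_ge0// sumr_ge0. Qed.

Lemma bitxorK (y : {ffun K -> bool}) : involutive (bitxor K ^~ y).
Proof. by move=> x; apply/ffunP => k; rewrite !ffunE addbK. Qed.

Lemma bitavg_xor f y : bitavg K (fun x => f (bitxor K x y)) = bitavg K f.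
Proof.
by rewrite /bitavg [in RHS](reindex_inj (inv_inj (@bitxorK y))).
Qed.

End Basics.

Lemma bitavg_swap (K K' : finType) (f : {ffun K -> bool} -> {ffun K' -> bool} -> R) :
  bitavg K (fun x => bitavg K' (f x)) = bitavg K' (fun y => bitavg K (f^~ y)).
Proof.
rewrite /bitavg -!mulr_sumr exchange_big !mulrA.
by rewrite [2^-1 ^+ #|K| * _]mulrC.
Qed.

Lemma extend_in (K K' : finType) (g : K' -> K) y k :
  injective g -> extend K K' g y (g k) = y k.
Proof.
move=> gi; rewrite ffunE; case: pickP => [k' /eqP/gi->//|/(_ k)].
by rewrite eqxx.
Qed.

Lemma extend_out (K K' : finType) (g : K' -> K) y k :
  (forall k', g k' != k) -> extend K K' g y k = false.
Proof. by move=> gk; rewrite ffunE; case: pickP => // k'; rewrite (negbTE (gk k')). Qed.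

(** That [h] ignores the bits on the image of [g] is expressed as invariance under flipping them.
    Shifting [x] by a uniform vector [y] on that image preserves the law of [x] and the value of
    [h], and makes the argument of [f] uniform for every fixed [x]. *)
Lemma bitavg_indep (K K' : finType) (g : K' -> K) (f : {ffun K' -> bool} -> R)
    (h : {ffun K -> bool} -> R) : injective g ->
  (forall x y, h (bitxor K x (extend K K' g y)) = h x) ->
  bitavg K (fun x => f (restr K K' g x) * h x) = bitavg K' f * bitavg K h.
Proof.
move=> gi hh.
transitivity (bitavg K' (fun y => bitavg K (fun x =>
    f (bitxor K' y (restr K K' g x)) * h x))).
  rewrite -[LHS](bitavg_cst K'); apply: eq_bitavg => y.
  rewrite -(bitavg_xor _ _ (extend K K' g y)); apply: eq_bitavg => x.
  rewrite hh; congr (f _ * _); apply/ffunP => k.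
  by rewrite [LHS]ffunE [LHS]ffunE extend_in// addbC !ffunE.
rewrite bitavg_swap mulrC -bitavgZ; under eq_bitavg => x.
  under eq_bitavg do rewrite mulrC.
  rewrite bitavgZ bitavg_xor; over.
by rewrite bitavgZ mulrC -bitavgZ; apply: eq_bitavg => x; rewrite mulrC.
Qed.

Lemma bitavg_restr (K K' : finType) (g : K' -> K) (f : {ffun K' -> bool} -> R) :
  injective g -> bitavg K (fun x => f (restr K K' g x)) = bitavg K' f.
Proof.
move=> gi; rewrite -[RHS]mulr1 -(bitavg_cst K 1) -(bitavg_indep K K' g)//.
by apply: eq_bitavg => x; rewrite mulr1.
Qed.

Lemma bitavg_prod_indep (K K' I : finType) (g : I -> K' -> K)
    (f : I -> {ffun K' -> bool} -> R) (r : seq I) : uniq r ->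
  (forall i, i \in r -> injective (g i)) ->
  (forall i j k k', i \in r -> j \in r -> g i k = g j k' -> i = j) ->
  bitavg K (fun x => \prod_(i <- r) f i (restr K K' (g i) x)) =
  \prod_(i <- r) bitavg K' (f i).
Proof.
elim: r => [|i r IH] /=; first by rewrite big_nil => _ _ _; under eq_bitavg do rewrite big_nil; rewrite bitavg_cst.
move=> /andP[ir ur] gi gd; rewrite big_cons -IH//; first last.
- by move=> j j' k k' jr j'r; apply: gd; rewrite inE ?jr ?j'r orbT.
- by move=> j jr; apply: gi; rewrite inE jr orbT.
under eq_bitavg do rewrite big_cons.
apply: bitavg_indep; first by apply: gi; rewrite mem_head.
move=> x y; apply: eq_big_seq => j jr; congr f; apply/ffunP => k.
rewrite [LHS]ffunE [LHS]ffunE extend_out ?addbF ?ffunE// => k'; apply/eqP => /gd ij.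
by move: ir; rewrite ij ?jr ?mem_head// inE jr orbT.
Qed.

(** Hoelder's inequality in exponential form. After subtracting [L i] from [phi i] it is convexity
    of the exponential, applied pointwise and then averaged. *)
Lemma bitavg_holder (K I : finType) (c L : I -> R) (phi : I -> {ffun K -> bool} -> R) :
  (forall i, 0 <= c i) -> \sum_i c i = 1 ->
  (forall i, bitavg K (fun x => expR (phi i x)) <= expR (L i)) ->
  bitavg K (fun x => expR (\sum_i c i * phi i x)) <= expR (\sum_i c i * L i).
Proof.
move=> c0 c1 H.
have jensen (y : I -> R) : expR (\sum_i c i * y i) <= \sum_i c i * expR (y i).
  (* Jensen from the tangent line of [expR] at the weighted mean [m]. *)
  set m := \sum_i c i * y i.
  apply: (@le_trans _ _ (\sum_i c i * (expR m * (1 + (y i - m))))); last first.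
    apply: ler_sum => i _; apply: ler_wpM2l => //.
    by rewrite -[in leRHS](subrKC m (y i)) expRD ler_pM2l ?expR_gt0// expR_ge1Dx.
  have -> : \sum_i c i * (expR m * (1 + (y i - m))) =
      expR m * (\sum_i c i * y i + (1 - m) * \sum_i c i).
    rewrite mulr_sumr -big_split mulr_sumr /=; apply: eq_bigr => i _; ring.
  by rewrite c1 -/m mulr1 addrC subrK mulr1.
have -> : \sum_i c i * L i = \sum_i c i * L i + 0 by rewrite addr0.
rewrite expRD -ler_pdivrMl ?expR_gt0// expR0 -bitavgZ.
apply: (@le_trans _ _ (bitavg K (fun x => \sum_i c i * (expR (- L i) * expR (phi i x))))).
  apply: bitavg_le => x; rewrite -expRN -expRD -sumrN -big_split /=.
  apply: le_trans (le_trans (jensen (fun i => phi i x - L i)) _).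
    by rewrite ler_expR; apply: ler_sum => i _; rewrite mulrBr addrC.
  by apply: ler_sum => i _; rewrite -expRD addrC.
rewrite bitavg_sum -c1; apply: ler_sum => i _.
rewrite !bitavgZ -[leRHS]mulr1 ler_wpM2l// expRN ler_pdivrMl ?expR_gt0// mulr1.
exact: H.
Qed.

(** Pairing [x] with its copy flipped at [v] allows the signs to be averaged out one at a time. *)
Lemma bitavg_flip (K : finType) (v : K) (f : {ffun K -> bool} -> R) :
  bitavg K f = bitavg K (fun x => (f x + f [ffun k => x k (+) (k == v)]) / 2).
Proof.
transitivity ((bitavg K f + bitavg K f) / 2); first by field.
rewrite -{2}(bitavg_xor _ f [ffun k => k == v]) -bitavgD mulrC -bitavgZ.
apply: eq_bitavg => x; rewrite mulrC; congr ((_ + f _) / 2).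
by apply/ffunP => k; rewrite !ffunE.
Qed.

End SignAverages.

(** * Elementary inequalities for the exponential, logarithm and cosine *)

Section RealBounds.
Variable R : realType.
Implicit Types x y u t z v : R.

(** The common tool of this section: a Taylor bound follows from the sign of the derivative of the
    difference of its two sides. *)
Lemma ge0_deriv_ge0 (f df : R -> R) b : 0 <= b -> f 0 = 0 ->
  (forall x, 0 <= x -> x <= b -> is_derive x (1 : R) f (df x)) ->
  (forall x, 0 < x -> x < b -> 0 <= df x) -> 0 <= f b.
Proof.
rewrite le_eqVlt => /orP[/eqP<- ->//|b0] f0 fd df0.
have [x||c] := @MVT R f df 0 b b0.
- by rewrite in_itv/= => /andP[/ltW ? /ltW ?]; apply: fd.
- apply: derivable_within_continuous => x.
  by rewrite in_itv/= => /andP[? ?]; apply: ex_derive; apply: fd.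
rewrite in_itv/= => /andP[c0 cb]; rewrite f0 !subr0 => ->.
by rewrite mulr_ge0// ?(ltW b0)// df0.
Qed.

Lemma expRN_le2 x : 0 <= x -> expR (- x) <= 1 - x + x ^+ 2 / 2.
Proof.
move=> x0; rewrite -subr_ge0.
apply: (@ge0_deriv_ge0 (fun x => 1 - x + x ^+ 2 / 2 - expR (- x))
  (fun x => - 1 + x + expR (- x)) x x0).
- by rewrite /= oppr0 expR0; ring.
- move=> y _ _; apply: is_derive_eq; rewrite /GRing.scale/=; by field.
- by move=> y _ _; have := expR_ge1Dx (- y); lra.
Qed.

Lemma expR_ge2 x : 0 <= x -> 1 + x + x ^+ 2 / 2 <= expR x.
Proof.
move=> x0; rewrite -subr_ge0.
apply: (@ge0_deriv_ge0 (fun x => expR x - (1 + x + x ^+ 2 / 2))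
  (fun x => expR x - (1 + x)) x x0).
- by rewrite /= expR0; ring.
- move=> y _ _; apply: is_derive_eq; rewrite /GRing.scale/=; by field.
- by move=> y _ _; have := expR_ge1Dx y; lra.
Qed.

Lemma expR_ge3 u : 1 + u + u ^+ 2 / 2 + u ^+ 3 / 6 <= expR u.
Proof.
rewrite -subr_ge0; have [u0|/ltW u0] := leP 0 u.
  apply: (@ge0_deriv_ge0 (fun u => expR u - (1 + u + u ^+ 2 / 2 + u ^+ 3 / 6))
    (fun u => expR u - (1 + u + u ^+ 2 / 2)) u u0).
  - by rewrite /= expR0; ring.
  - move=> y _ _; apply: is_derive_eq; rewrite /GRing.scale/=; by field.
  - by move=> y y0 _; rewrite subr_ge0 expR_ge2// ltW.
rewrite -{}[u in expR u]opprK; have : 0 <= - u by rewrite oppr_ge0.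
move: (- u) (opprK u) => v <- {u u0} v0.
apply: (@ge0_deriv_ge0 (fun v => expR (- v) - (1 + - v + (- v) ^+ 2 / 2 + (- v) ^+ 3 / 6))
    (fun v => 1 - v + v ^+ 2 / 2 - expR (- v)) v v0).
- by rewrite /= oppr0 expR0; ring.
- move=> y _ _; apply: is_derive_eq; rewrite /GRing.scale/=; by field.
- by move=> y y0 _; rewrite subr_ge0 expRN_le2// ltW.
Qed.

(** Multiply by [expR (- (y ^+ 2 / 2))]: the derivative of the resulting difference is nonnegative
    because [tanh z <= z] for [z >= 0], which is the auxiliary fact [P]. *)
Lemma cosh_le_expR_sqr y : (expR y + expR (- y)) / 2 <= expR (y ^+ 2 / 2).
Proof.
wlog y0 : y / 0 <= y.
  move=> W; have [/W//|y0] := leP 0 y.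
  by have := W (- y); rewrite opprK sqrrN addrC; apply; rewrite oppr_ge0 ltW.
have P (z : R) : 0 <= z -> 0 <= z * (expR z + expR (- z)) - (expR z - expR (- z)).
  move=> z0.
  apply: (@ge0_deriv_ge0 (fun z => z * (expR z + expR (- z)) - (expR z - expR (- z)))
    (fun z => z * (expR z - expR (- z))) z z0).
  - by rewrite /= oppr0 expR0; ring.
  - move=> t _ _; apply: is_derive_eq; rewrite /GRing.scale/=; ring.
  - move=> t t0 _; rewrite mulr_ge0 ?(ltW t0)// subr_ge0 ler_expR.
    by rewrite (@le_trans _ _ 0) ?oppr_le0// ltW.
suff H : 0 <= 2 - (expR y + expR (- y)) * expR (- (y ^+ 2 / 2)).
  by move: H; rewrite subr_ge0 [expR (- (_ / _))]expRN ler_pdivrMr ?expR_gt0// => H;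
    rewrite ler_pdivrMr// mulrC.
apply: (@ge0_deriv_ge0 (fun z => 2 - (expR z + expR (- z)) * expR (- (z ^+ 2 / 2)))
  (fun z => (z * (expR z + expR (- z)) - (expR z - expR (- z))) * expR (- (z ^+ 2 / 2))) y y0).
- by rewrite /= expr0n /= mul0r !oppr0 expR0; ring.
- move=> t _ _; apply: is_derive_eq; rewrite /GRing.scale/=; by field.
- by move=> t t0 _; rewrite mulr_ge0 ?expR_ge0// P// ltW.
Qed.

Lemma ln1D_ge4 t : 0 <= t -> t - t ^+ 2 / 2 + t ^+ 3 / 3 - t ^+ 4 / 4 <= ln (1 + t).
Proof.
move=> t0; rewrite -subr_ge0.
apply: (@ge0_deriv_ge0 (fun t => ln (1 + t) - (t - t ^+ 2 / 2 + t ^+ 3 / 3 - t ^+ 4 / 4))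
  (fun t => t ^+ 4 / (1 + t)) t t0).
- by rewrite /= addr0 ln1; ring.
- move=> y y0 _.
  have y1 : 0 < 1 + y by lra.
  have := is_derive1_ln y1 => d; apply: is_derive_eq; rewrite /GRing.scale/=; field; lra.
- by move=> y y0 _; rewrite divr_ge0// ?exprn_ge0//; lra.
Qed.

(** The coefficient [1 / 2] of the fourth power, instead of the Taylor coefficient [1 / 4], absorbs
    the whole tail of the series on this range of [t]. *)
Lemma ln1B_le4 t : 0 <= t -> t <= 2^-1 ->
  - ln (1 - t) <= t + t ^+ 2 / 2 + t ^+ 3 / 3 + t ^+ 4 / 2.
Proof.
move=> t0 t1; rewrite -subr_ge0.
apply: (@ge0_deriv_ge0 (fun t => t + t ^+ 2 / 2 + t ^+ 3 / 3 + t ^+ 4 / 2 - - ln (1 - t))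
  (fun t => t ^+ 3 * (1 - 2 * t) / (1 - t)) t t0).
- by rewrite /= subr0 ln1; ring.
- move=> y y0 yt.
  have y1 : 0 < 1 - y by lra.
  have := is_derive1_ln y1 => d; apply: is_derive_eq; rewrite /GRing.scale/=; field; lra.
- by move=> y y0 yt; rewrite divr_ge0// ?mulr_ge0 ?exprn_ge0//; lra.
Qed.

(** By evenness take [u >= 0]; starting from [cos <= 1], bounds for sine and cosine are integrated
    alternately. *)
Lemma cos_bounds u : 1 - u ^+ 2 / 2 <= cos u <= 1 - u ^+ 2 / 2 + u ^+ 4 / 24.
Proof.
wlog u0 : u / 0 <= u.
  move=> W; have [/W//|u0] := leP 0 u.
  have := W (- u); rewrite cosN sqrrN (_ : (- u) ^+ 4 = u ^+ 4); last by ring.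
  by apply; rewrite oppr_ge0 ltW.
have sinle (z : R) : 0 <= z -> 0 <= z - sin z.
  move=> z0; apply: (@ge0_deriv_ge0 (fun z => z - sin z) (fun z => 1 - cos z) z z0).
  - by rewrite /= sin0; ring.
  - by move=> t _ _; rewrite subr_ge0 cos_le1.
have cosge (z : R) : 0 <= z -> 0 <= cos z - (1 - z ^+ 2 / 2).
  move=> z0; apply: (@ge0_deriv_ge0 (fun z => cos z - (1 - z ^+ 2 / 2)) (fun z => z - sin z) z z0).
  - by rewrite /= cos0; ring.
  - move=> t _ _; by apply: is_derive_eq; rewrite /GRing.scale/=; field.
  - by move=> t t0 _; rewrite sinle// ltW.
have singe (z : R) : 0 <= z -> 0 <= sin z - (z - z ^+ 3 / 6).
  move=> z0; apply: (@ge0_deriv_ge0 (fun z => sin z - (z - z ^+ 3 / 6))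
    (fun z => cos z - (1 - z ^+ 2 / 2)) z z0).
  - by rewrite /= sin0; ring.
  - move=> t _ _; by apply: is_derive_eq; rewrite /GRing.scale/=; field.
  - by move=> t t0 _; rewrite cosge// ltW.
have cosle (z : R) : 0 <= z -> 0 <= 1 - z ^+ 2 / 2 + z ^+ 4 / 24 - cos z.
  move=> z0; apply: (@ge0_deriv_ge0 (fun z => 1 - z ^+ 2 / 2 + z ^+ 4 / 24 - cos z)
    (fun z => sin z - (z - z ^+ 3 / 6)) z z0).
  - by rewrite /= cos0; ring.
  - move=> t _ _; by apply: is_derive_eq; rewrite /GRing.scale/=; field.
  - by move=> t t0 _; rewrite singe// ltW.
by rewrite -subr_ge0 cosge//= -subr_ge0 cosle.
Qed.

End RealBounds.

(** * Moments and exponential moments of sums of random signs *)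

Section SignSums.
Variables (R : realType) (K : finType).

Definition signsum (c : K -> R) (r : seq K) (x : {ffun K -> bool}) : R :=
  \sum_(v <- r) (-1) ^+ x v * c v.

Lemma signsum_nil c x : signsum c [::] x = 0.
Proof. by rewrite /signsum big_nil. Qed.

Lemma bitavg_signsum_cons (phi : R -> R) c v r : v \notin r ->
  bitavg R K (fun x => phi (signsum c (v :: r) x)) =
  bitavg R K (fun x => (phi (signsum c r x + c v) + phi (signsum c r x - c v)) / 2).
Proof.
move=> vr; rewrite (bitavg_flip _ _ v); apply: eq_bitavg => x.
have -> : signsum c (v :: r) x = signsum c r x + (-1) ^+ x v * c v.
  by rewrite /signsum big_cons addrC.
have -> : signsum c (v :: r) [ffun k => x k (+) (k == v)] = signsum c r x - (-1) ^+ x v * c v.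
  rewrite /signsum big_cons ffunE eqxx addbT signrN mulNr addrC; congr (_ - _).
  apply: eq_big_seq => u ur; rewrite ffunE (_ : u == v = false) ?addbF//.
  by apply: contraNF vr => /eqP <-.
case: (x v); rewrite ?expr0 ?expr1 ?mul1r ?mulN1r ?opprK//.
by rewrite [phi _ + _]addrC.
Qed.

(** The bound is the exact value for a centred Gaussian of variance [size r]. Averaging out one sign
    costs a factor [expR lam] and, by the bound on the hyperbolic cosine, replaces [lam] by
    [lam + 2 * lam ^+ 2]; the induction closes since [(1 - 2 * lam) * b >= a] for the [a] and [b]
    below. *)
Lemma bitavg_expR_signsum_sqr (lam : R) r : uniq r -> 0 <= lam ->
  2 * lam * (size r)%:R < 1 ->
  bitavg R K (fun x => expR (lam * signsum (fun=> 1) r x ^+ 2)) <=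
  expR (- (ln (1 - 2 * lam * (size r)%:R) / 2)).
Proof.
elim: r lam => [|v r IH] lam /=.
  move=> _ _ _; rewrite mulr0 subr0 ln1 mul0r oppr0.
  under eq_bitavg do rewrite signsum_nil expr0n mulr0.
  by rewrite bitavg_cst.
move=> /andP[vr ur] lam0; rewrite -[(size r).+1%:R]natr1; set n : R := (size r)%:R => lam1.
have n0 : 0 <= n by rewrite ler0n.
rewrite (bitavg_signsum_cons (fun s => expR (lam * s ^+ 2)))//.
apply: (@le_trans _ _ (expR lam * bitavg R K
    (fun x => expR ((lam + 2 * lam ^+ 2) * signsum (fun=> 1) r x ^+ 2)))).
  rewrite -bitavgZ; apply: bitavg_le => x; set S := signsum _ _ _.
  have -> : (expR (lam * (S + 1) ^+ 2) + expR (lam * (S - 1) ^+ 2)) / 2 =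
     expR (lam + lam * S ^+ 2) * ((expR (2 * lam * S) + expR (- (2 * lam * S))) / 2).
    rewrite mulrA mulrDr -!expRD; congr ((expR _ + expR _) / 2); ring.
  rewrite (_ : (lam + 2 * lam ^+ 2) * S ^+ 2 = lam * S ^+ 2 + (2 * lam * S) ^+ 2 / 2); last by field.
  by rewrite [expR (_ + _ / 2)]expRD [leRHS]mulrA -expRD ler_pM2l ?expR_gt0// cosh_le_expR_sqr.
have h : 0 <= lam * n by rewrite mulr_ge0.
have h3 : 0 <= lam ^+ 3 * n by rewrite mulr_ge0// exprn_ge0.
have lam2 : 0 < 1 - 2 * lam by nra.
have IHl : 2 * (lam + 2 * lam ^+ 2) * n < 1 by nra.
apply: le_trans (ler_wpM2l _ (IH _ ur _ IHl)) _; first exact: expR_ge0.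
  by rewrite addr_ge0// mulr_ge0// sqr_ge0.
rewrite -expRD ler_expR -/n.
set a := 1 - 2 * lam * (n + 1); set b := 1 - 2 * (lam + 2 * lam ^+ 2) * n.
have a0 : 0 < a by rewrite /a; lra.
have b0 : 0 < b by rewrite /b; lra.
have l1 : ln (1 - 2 * lam) <= - (2 * lam) by apply: le_ln1Dx; lra.
have l2 : ln a <= ln b + ln (1 - 2 * lam).
  by rewrite -lnM ?posrE// ler_ln ?posrE ?mulr_gt0// /a /b; nra.
lra.
Qed.

(** Same induction with [lam - 2 * lam ^+ 2]. Here the Gaussian value is not quite preserved, and
    each sign adds an error [4 * lam ^+ 2] to the exponent. *)
Lemma bitavg_expRN_signsum_sqr (lam : R) r : uniq r -> 0 <= lam -> lam <= 4^-1 ->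
  bitavg R K (fun x => expR (- (lam * signsum (fun=> 1) r x ^+ 2))) <=
  expR (- (ln (1 + 2 * lam * (size r)%:R) / 2) + 4 * (size r)%:R * lam ^+ 2).
Proof.
elim: r lam => [|v r IH] lam /=.
  move=> _ _ _; rewrite !mulr0 mul0r !addr0 ln1 mul0r oppr0.
  under eq_bitavg do rewrite signsum_nil expr0n mulr0 oppr0.
  by rewrite bitavg_cst.
move=> /andP[vr ur] lam0 lam1; rewrite -[(size r).+1%:R]natr1; set n : R := (size r)%:R.
have n0 : 0 <= n by rewrite ler0n.
rewrite (bitavg_signsum_cons (fun s => expR (- (lam * s ^+ 2))))//.
apply: (@le_trans _ _ (expR (- lam) * bitavg R K
    (fun x => expR (- ((lam - 2 * lam ^+ 2) * signsum (fun=> 1) r x ^+ 2))))).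
  rewrite -bitavgZ; apply: bitavg_le => x; set S := signsum _ _ _.
  have -> : (expR (- (lam * (S + 1) ^+ 2)) + expR (- (lam * (S - 1) ^+ 2))) / 2 =
     expR (- lam - lam * S ^+ 2) * ((expR (2 * lam * S) + expR (- (2 * lam * S))) / 2).
    rewrite mulrA mulrDr -!expRD [in RHS]addrC; congr ((expR _ + expR _) / 2); ring.
  rewrite (_ : - ((lam - 2 * lam ^+ 2) * S ^+ 2) = - (lam * S ^+ 2) + (2 * lam * S) ^+ 2 / 2); last by field.
  by rewrite [expR (_ + _ / 2)]expRD [leRHS]mulrA -expRD ler_pM2l ?expR_gt0// cosh_le_expR_sqr.
have l0 : 0 <= lam - 2 * lam ^+ 2 by nra.
apply: le_trans (ler_wpM2l _ (IH _ ur l0 _)) _; first exact: expR_ge0.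
  by have := sqr_ge0 lam; lra.
rewrite -expRD ler_expR -/n.
have sq : (lam - 2 * lam ^+ 2) ^+ 2 <= lam ^+ 2.
  by rewrite ler_sqr ?nnegrE//; have := sqr_ge0 lam; lra.
have h0 : 0 <= lam * n by rewrite mulr_ge0.
have h1 : 0 <= (lam - 2 * lam ^+ 2) * n by rewrite mulr_ge0.
have h2 : n * (lam - 2 * lam ^+ 2) ^+ 2 <= n * lam ^+ 2 by rewrite ler_wpM2l.
have h3 : 0 <= lam ^+ 2 by exact: sqr_ge0.
have l1 : ln (1 + (2 * lam + 8 * lam ^+ 2)) <= 2 * lam + 8 * lam ^+ 2.
  by apply: le_ln1Dx; lra.
have l2 : ln (1 + 2 * lam * (n + 1)) <=
    ln (1 + (2 * lam + 8 * lam ^+ 2)) + ln (1 + 2 * (lam - 2 * lam ^+ 2) * n).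
  rewrite -lnM ?posrE ?ler_ln ?posrE ?mulr_gt0//; try by lra.
  have : 0 <= lam * n * (lam ^+ 2 * (1 - 4 * lam)) by rewrite !mulr_ge0// subr_ge0; lra.
  lra.
lra.
Qed.

Lemma bitavg_signsum_sqr c r : uniq r ->
  bitavg R K (fun x => signsum c r x ^+ 2) = \sum_(v <- r) c v ^+ 2.
Proof.
elim: r => [|v r IH] /=.
  by move=> _; rewrite big_nil; under eq_bitavg do rewrite signsum_nil expr0n; exact: bitavg_cst.
move=> /andP[vr ur]; rewrite (bitavg_signsum_cons (fun s => s ^+ 2))// big_cons -IH// addrC.
rewrite -[c v ^+ 2](bitavg_cst _ K) -bitavgD; apply: eq_bitavg => x; by field.
Qed.

Lemma bitavg_signsum_pow4 c r : uniq r ->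
  bitavg R K (fun x => signsum c r x ^+ 4) <= 3 * (\sum_(v <- r) c v ^+ 2) ^+ 2.
Proof.
elim: r => [|v r IH] /=.
  move=> _; rewrite big_nil; under eq_bitavg do rewrite signsum_nil expr0n.
  by rewrite bitavg_cst expr0n mulr0.
move=> /andP[vr ur]; rewrite (bitavg_signsum_cons (fun s => s ^+ 4))// big_cons.
have -> : bitavg R K (fun x => ((signsum c r x + c v) ^+ 4 + (signsum c r x - c v) ^+ 4) / 2) =
    bitavg R K (fun x => signsum c r x ^+ 4) +
    6 * c v ^+ 2 * bitavg R K (fun x => signsum c r x ^+ 2) + c v ^+ 4.
  rewrite -[c v ^+ 4](bitavg_cst _ K) -bitavgZ -!bitavgD.
  by apply: eq_bitavg => x; field.
rewrite bitavg_signsum_sqr//; move: (IH ur); set A := \sum_(_ <- _) _.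
rewrite (_ : c v ^+ 4 = c v ^+ 2 * c v ^+ 2); last by ring.
move: (sqr_ge0 (c v)); nra.
Qed.

(** Read from right to left with [b = 0], it turns a product of cosines into a single cosine
    averaged over random signs. The phase [b] carries the induction. *)
Lemma bitavg_cos_signsum (b : R) c r : uniq r ->
  bitavg R K (fun x => cos (b + signsum c r x)) = cos b * \prod_(v <- r) cos (c v).
Proof.
elim: r b => [|v r IH] b /=.
  by move=> _; rewrite big_nil; under eq_bitavg do rewrite signsum_nil addr0; rewrite bitavg_cst mulr1.
move=> /andP[vr ur]; rewrite (bitavg_signsum_cons (fun s => cos (b + s)))// big_cons.
rewrite mulrCA -IH// -bitavgZ; apply: eq_bitavg => x.
rewrite !addrA [cos (_ + c v)]cosD [cos (_ - c v)]cosD cosN sinN; by field.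
Qed.

End SignSums.

(** * Bilinear forms in two independent sign vectors *)

Section BlockBound.
Variable R : realType.

Lemma bitavg_fubini (K K1 K2 : finType) (g1 : K1 -> K) (g2 : K2 -> K)
    (f : {ffun K1 -> bool} -> {ffun K2 -> bool} -> R) :
  injective g1 -> injective g2 -> (forall k1 k2, g1 k1 != g2 k2) ->
  bitavg R K (fun x => f (restr K K1 g1 x) (restr K K2 g2 x)) =
  bitavg R K2 (fun y2 => bitavg R K1 (f^~ y2)).
Proof.
move=> i1 i2 g12.
rewrite -[RHS](bitavg_restr _ _ _ g2)//.
transitivity (bitavg R K1 (fun y => bitavg R K (fun x =>
    f (bitxor K1 y (restr K K1 g1 x)) (restr K K2 g2 x)))).
  rewrite -[LHS](bitavg_cst _ K1); apply: eq_bitavg => y.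
  rewrite -(bitavg_xor _ _ _ (extend K K1 g1 y)); apply: eq_bitavg => x.
  congr (f _ _); apply/ffunP => k.
    by rewrite [LHS]ffunE [LHS]ffunE extend_in// addbC !ffunE.
  rewrite [LHS]ffunE [LHS]ffunE extend_out ?addbF ?ffunE// => k'; exact: g12.
rewrite bitavg_swap; apply: eq_bitavg => x.
by rewrite (bitavg_xor _ _ (f^~ _)).
Qed.

Lemma sqr_sum_le (n : nat) (a : 'I_n -> R) : (\sum_i a i) ^+ 2 <= n%:R * \sum_i a i ^+ 2.
Proof.
have : 0 <= \sum_i \sum_j (a i - a j) ^+ 2.
  by apply: sumr_ge0 => i _; apply: sumr_ge0 => j _; exact: sqr_ge0.
have -> : \sum_i \sum_j (a i - a j) ^+ 2 =
    2 * (n%:R * \sum_i a i ^+ 2 - (\sum_i a i) ^+ 2).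
  have e1 : \sum_(i < n) \sum_(j < n) a j ^+ 2 = n%:R * \sum_i a i ^+ 2.
    by rewrite sumr_const card_ord mulr_natl.
  have e2 : \sum_(i < n) \sum_(j < n) a i ^+ 2 = n%:R * \sum_i a i ^+ 2.
    by rewrite exchange_big.
  have e3 : \sum_(i < n) \sum_(j < n) a i * a j = (\sum_i a i) ^+ 2.
    by rewrite expr2 mulr_suml; apply: eq_bigr => i _; rewrite mulr_sumr.
  transitivity (\sum_(i < n) \sum_(j < n) (a i ^+ 2 + a j ^+ 2 + (- 2) * (a i * a j))).
    by apply: eq_bigr => i _; apply: eq_bigr => j _; ring.
  under eq_bigr => i _ do rewrite !big_split/= -[X in _ + X]mulr_sumr.
  by rewrite !big_split/= -[X in _ + X]mulr_sumr e1 e2 e3; ring.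
lra.
Qed.

Definition bilinsum (b : nat) (m : 'I_b -> 'I_b -> R) (y1 y2 : {ffun 'I_b -> bool}) : R :=
  \sum_i (-1) ^+ y1 i * \sum_j (-1) ^+ y2 j * m i j.

Lemma bilinsum_sqr b m : bitavg R 'I_b (fun y2 => bitavg R 'I_b (fun y1 =>
   bilinsum b m y1 y2 ^+ 2)) = \sum_i \sum_j m i j ^+ 2.
Proof.
transitivity (bitavg R 'I_b (fun y2 => \sum_i signsum R 'I_b (m i) (index_enum _) y2 ^+ 2)).
  apply: eq_bitavg => y2.
  by rewrite -(bitavg_signsum_sqr _ _ (fun i => signsum R 'I_b (m i) (index_enum _) y2))// index_enum_uniq.
by rewrite bitavg_sum; apply: eq_bigr => i _; rewrite bitavg_signsum_sqr// index_enum_uniq.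
Qed.

(** For fixed [y2] the form is a signed sum with coefficients [c i y2], each itself a signed sum.
    The fourth moment bound is used for both layers, with Cauchy-Schwarz in between. *)
Lemma bilinsum_pow4 b m : (forall i j, m i j ^+ 2 <= 1) ->
  bitavg R 'I_b (fun y2 => bitavg R 'I_b (fun y1 => bilinsum b m y1 y2 ^+ 4)) <=
  9 * b%:R ^+ 2 * \sum_i \sum_j m i j ^+ 2.
Proof.
move=> m1; set c := fun i y => signsum R 'I_b (m i) (index_enum _) y.
apply: (@le_trans _ _ (bitavg R 'I_b (fun y2 => 3 * (b%:R * \sum_i c i y2 ^+ 4)))).
  apply: bitavg_le => y2.
  apply: le_trans (bitavg_signsum_pow4 _ _ (c^~ y2) _ (index_enum_uniq _)) _.
  rewrite ler_pM2l//; apply: le_trans (sqr_sum_le _ _) _.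
  by under eq_bigr do rewrite -exprM.
rewrite !bitavgZ bitavg_sum.
have -> : 9 * b%:R ^+ 2 * (\sum_i \sum_j m i j ^+ 2) =
    3 * (b%:R * \sum_i (3 * (b%:R * \sum_j m i j ^+ 2))).
  by rewrite -!mulr_sumr; ring.
rewrite ler_pM2l// ler_wpM2l// ler_sum// => i _.
apply: le_trans (bitavg_signsum_pow4 _ _ (m i) _ (index_enum_uniq _)) _.
rewrite ler_pM2l// expr2 ler_wpM2r//; first by apply: sumr_ge0 => j _; exact: sqr_ge0.
rewrite -[b in b%:R]card_ord -sumr_const ler_sum// => j _; exact: m1.
Qed.

(** Nonnegativity is what permits raising the upper bound on this average to the power [D ^ 2]. *)
Lemma bitavg_cos_bilinsum_ge0 b m (t : R) : (forall i j, m i j ^+ 2 <= 1) ->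
  t ^+ 2 * b%:R ^+ 2 <= 1 ->
  0 <= bitavg R 'I_b (fun y2 => bitavg R 'I_b (fun y1 => cos (t * bilinsum b m y1 y2))).
Proof.
move=> m1 tb.
apply: (@le_trans _ _ (bitavg R 'I_b (fun y2 => bitavg R 'I_b (fun y1 =>
    1 + - (t ^+ 2 / 2) * bilinsum b m y1 y2 ^+ 2)))).
  under eq_bitavg do rewrite bitavgD bitavgZ bitavg_cst.
  rewrite bitavgD bitavgZ bitavg_cst bilinsum_sqr.
  have : \sum_i \sum_j m i j ^+ 2 <= b%:R ^+ 2.
    rewrite expr2 -[b in b%:R]card_ord -{1}[#|'I_b|]sum1_card natr_sum mulr_suml ler_sum// => i _.
    by rewrite mul1r -sumr_const ler_sum// => j _; exact: m1.
  by have := sqr_ge0 t; nra.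
apply: bitavg_le => y2; apply: bitavg_le => y1.
have /andP[+ _] := cos_bounds R (t * bilinsum b m y1 y2); rewrite exprMn; lra.
Qed.

(** The quadratic Taylor term gives the main decay. The quartic one is at most [9 / 24 * z] times
    [t ^+ 2] times the sum of the squared entries, hence is absorbed by the factor [1 - z]. *)
Lemma bitavg_cos_bilinsum_le b m (t z : R) : (forall i j, m i j ^+ 2 <= 1) ->
  t ^+ 2 * b%:R ^+ 2 <= z ->
  bitavg R 'I_b (fun y2 => bitavg R 'I_b (fun y1 => cos (t * bilinsum b m y1 y2))) <=
  expR (- (t ^+ 2 * (1 - z) / 2 * \sum_i \sum_j m i j ^+ 2)).
Proof.
move=> m1 tb.
apply: (@le_trans _ _ (bitavg R 'I_b (fun y2 => bitavg R 'I_b (fun y1 =>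
    1 + - (t ^+ 2 / 2) * bilinsum b m y1 y2 ^+ 2 + t ^+ 4 / 24 * bilinsum b m y1 y2 ^+ 4)))).
  apply: bitavg_le => y2; apply: bitavg_le => y1.
  have /andP[_] := cos_bounds R (t * bilinsum b m y1 y2); rewrite !exprMn; lra.
under eq_bitavg do rewrite !bitavgD !bitavgZ bitavg_cst.
rewrite !bitavgD 2!bitavgZ bitavg_cst bilinsum_sqr.
have := bilinsum_pow4 b m m1; set h := \sum_i _.
have h0 : 0 <= h by apply: sumr_ge0 => i _; apply: sumr_ge0 => j _; exact: sqr_ge0.
set P := bitavg _ _ _ => hP; apply: le_trans (expR_ge1Dx _).
have t4 : t ^+ 4 = t ^+ 2 * t ^+ 2 by ring.
have h1 : t ^+ 4 * P <= t ^+ 4 * (9 * b%:R ^+ 2 * h).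
  by rewrite ler_wpM2l// t4; apply: mulr_ge0; exact: sqr_ge0.
have h2 : t ^+ 2 * h * (t ^+ 2 * b%:R ^+ 2) <= t ^+ 2 * h * z.
  by rewrite ler_wpM2l//; apply: mulr_ge0 => //; exact: sqr_ge0.
have h3 : 0 <= t ^+ 2 * h * (t ^+ 2 * b%:R ^+ 2).
  by apply: mulr_ge0; apply: mulr_ge0 => //; exact: sqr_ge0.
move: h1; rewrite t4; lra.
Qed.

End BlockBound.

(** * Correlations of random sign vectors and the estimate for one block *)

Section RandomVectors.
Variable R : realType.

(* [D ^ 2] is the dimension, so that dividing by [D] normalises the inner
   product of two sign vectors to variance one. *)
Definition corr (V : finType) (D : nat) (x : {ffun V * 'I_(D ^ 2) -> bool}) (u v : V) : R :=
  (\sum_c (-1) ^+ x (u, c) * (-1) ^+ x (v, c)) / D%:R.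

Lemma corrC V D x u v : corr V D x u v = corr V D x v u.
Proof. by congr (_ / _); apply: eq_bigr => c _; rewrite mulrC. Qed.

Definition coord (V : finType) (D : nat) (c : 'I_(D ^ 2)) (v : V) : V * 'I_(D ^ 2) := (v, c).

Lemma bitavg_prod_coord (V : finType) D (f : {ffun V -> bool} -> R) :
  bitavg R (V * 'I_(D ^ 2))%type (fun x => \prod_c f (restr _ V (coord V D c) x)) =
  bitavg R V f ^+ (D ^ 2).
Proof.
rewrite (bitavg_prod_indep _ _ _ _ _ (fun=> f)) ?index_enum_uniq//.
- by rewrite prodr_const card_ord.
- by move=> c _ u v [].
- by move=> c c' u v _ _ [].
Qed.

Section Block.
Variables (b D : nat).
Local Notation side := (bool * 'I_b)%type.
Local Notation bits := (side * 'I_(D ^ 2))%type.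

Definition leftv (i : 'I_b) : side := (false, i).
Definition rightv (i : 'I_b) : side := (true, i).

(** Up to the factor [D%:R^-1], the share of a single coordinate of the ambient space in a weighted
    sum of correlations across the block. *)
Definition bilin_col (m : 'I_b -> 'I_b -> R) (y : {ffun side -> bool}) : R :=
  bilinsum R b m (restr _ _ leftv y) (restr _ _ rightv y).

Lemma bitavg_bilin_col m (phi : R -> R) :
  bitavg R side (fun y => phi (bilin_col m y)) =
  bitavg R 'I_b (fun y2 => bitavg R 'I_b (fun y1 => phi (bilinsum R b m y1 y2))).
Proof.
rewrite -(bitavg_fubini _ side _ _ leftv rightv (fun y1 y2 => phi (bilinsum R b m y1 y2)))//.
- by move=> i j [].
- by move=> i j [].
Qed.

Lemma sum_corr_bilin m (x : {ffun bits -> bool}) :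
  \sum_i \sum_j m i j * corr side D x (leftv i) (rightv j) =
  \sum_c bilin_col m (restr _ _ (coord side D c) x) / D%:R.
Proof.
transitivity (\sum_i \sum_j \sum_c
    m i j * (-1) ^+ x (leftv i, c) * (-1) ^+ x (rightv j, c) / D%:R).
  apply: eq_bigr => i _; apply: eq_bigr => j _.
  by rewrite /corr mulrA mulr_sumr mulr_suml; apply: eq_bigr => c _; rewrite mulrA.
under eq_bigr => i _ do rewrite exchange_big.
rewrite exchange_big /=; apply: eq_bigr => c _.
rewrite /bilin_col /bilinsum mulr_suml; apply: eq_bigr => i _.
rewrite mulr_sumr mulr_suml; apply: eq_bigr => j _.
by rewrite !ffunE; congr (_ * _); rewrite -mulrA mulrC -mulrA.
Qed.

(* Flipping all left vertices in a random set of coordinates makes the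
   contributions of the coordinates symmetric without changing the law. *)
Lemma bitavg_cos_sum_bilin m (t : R) :
  bitavg R bits (fun x => cos (\sum_c t * bilin_col m (restr _ _ (coord side D c) x))) =
  bitavg R side (fun y => cos (t * bilin_col m y)) ^+ (D ^ 2).
Proof.
set u := fun c x => t * bilin_col m (restr _ _ (coord side D c) x).
rewrite -bitavg_prod_coord.
transitivity (bitavg R 'I_(D ^ 2) (fun e => bitavg R bits (fun x =>
    cos (0 + signsum R 'I_(D ^ 2) (u^~ x) (index_enum _) e)))).
  rewrite -[LHS](bitavg_cst _ 'I_(D ^ 2)); apply: eq_bitavg => e.
  rewrite -(bitavg_xor _ _ _ [ffun k : bits => ~~ k.1.1 && e k.2]).
  apply: eq_bitavg => x; rewrite add0r; congr cos; apply: eq_bigr => c _.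
  rewrite mulrCA; congr (_ * _); rewrite /bilin_col /bilinsum mulr_sumr.
  apply: eq_bigr => i _; rewrite mulrA; congr (_ * _).
    by rewrite !ffunE/= signr_addb mulrC.
  by apply: eq_bigr => j _; rewrite !ffunE/= addbF.
rewrite bitavg_swap; apply: eq_bitavg => x.
by rewrite bitavg_cos_signsum ?index_enum_uniq// cos0 mul1r.
Qed.

(** Each factor is the mean of [1] and a cosine with weights [1 - z] and [z]. Expanding the product
    selects a random set [H] of pairs, each kept with probability [z], and for fixed [H] the product
    of cosines has mean at most [expR (- y)] to the power [#|H|]. *)
Lemma block_bound (z : R) : 0 < z -> z <= 1 -> (0 < D)%N ->
  z ^+ 2 * b%:R ^+ 2 / D%:R ^+ 2 <= z ->
  bitavg R bits (fun x => \prod_(e : 'I_b * 'I_b)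
    (1 - z + z * cos (z * corr side D x (leftv e.1) (rightv e.2)))) <=
  expR (- (z ^+ 3 / 2 * (1 - z) ^+ 2 * b%:R ^+ 2)).
Proof.
move=> z0 z1 D0 vz.
have Dp : 0 < D%:R :> R by rewrite ltr0n.
set y := z ^+ 2 * (1 - z) / 2.
(* Random signs on [H] turn the product into the cosine of one bilinear form with entries [0], [1],
   [-1]. Its mean factorises over the [D ^ 2] coordinates, each with the small argument [z / D]. *)
have step (H : {set 'I_b * 'I_b}) :
  bitavg R bits (fun x => \prod_(e in H) cos (z * corr side D x (leftv e.1) (rightv e.2))) <=
  expR (- y) ^+ #|H|.
  rewrite [leLHS](_ : _ = bitavg R ('I_b * 'I_b)%type (fun e => bitavg R bits (fun x =>
      cos (0 + signsum R _ (fun e => z * corr side D x (leftv e.1) (rightv e.2)) (enum H) e)))).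
    rewrite -[leRHS](bitavg_cst _ ('I_b * 'I_b)%type); apply: bitavg_le => e.
    pose m i j : R := if (i, j) \in H then (-1) ^+ e (i, j) else 0.
    have m1 i j : m i j ^+ 2 <= 1.
      by rewrite /m; case: ifP => _; rewrite ?sqrr_sign// expr0n ler01.
    have hm : \sum_i \sum_j m i j ^+ 2 = #|H|%:R.
      rewrite pair_big /= -sum1_card natr_sum [RHS]big_mkcond /=.
      apply: eq_bigr => -[i j] _ /=; rewrite /m; case: ifP => _; by rewrite ?sqrr_sign// expr0n.
    have -> : bitavg R bits (fun x => cos (0 + signsum R _
        (fun e => z * corr side D x (leftv e.1) (rightv e.2)) (enum H) e)) =
      bitavg R side (fun y => cos (z / D%:R * bilin_col m y)) ^+ (D ^ 2).
      rewrite -bitavg_cos_sum_bilin; apply: eq_bitavg => x; congr cos; rewrite add0r.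
      have -> : \sum_c z / D%:R * bilin_col m (restr _ _ (coord side D c) x) =
          z * \sum_c bilin_col m (restr _ _ (coord side D c) x) / D%:R.
        by rewrite mulr_sumr; apply: eq_bigr => c _; ring.
      rewrite -sum_corr_bilin pair_big /= mulr_sumr /signsum big_enum /= big_mkcond /=.
      apply: eq_bigr => -[i j] _ /=; rewrite /m; case: ifP => _; last by rewrite mul0r mulr0.
      by rewrite mulrCA.
    rewrite (bitavg_bilin_col m (fun s => cos (z / D%:R * s))).
    have t2 : (z / D%:R) ^+ 2 * b%:R ^+ 2 = z ^+ 2 * b%:R ^+ 2 / D%:R ^+ 2.
      by rewrite exprMn exprVn; ring.
    apply: le_trans (lerXn2r _ _ _ (bitavg_cos_bilinsum_le R b m (z / D%:R) z m1 _)) _.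
    - by rewrite nnegrE; apply: bitavg_cos_bilinsum_ge0 => //; rewrite t2 (le_trans vz).
    - by rewrite nnegrE expR_ge0.
    - by rewrite t2.
    rewrite -!expRM_natl ler_expR hm natrX /y.
    rewrite le_eqVlt; apply/orP; left; apply/eqP; field.
    by rewrite gt_eqF.
  rewrite bitavg_swap; apply: eq_bitavg => x.
  by rewrite bitavg_cos_signsum ?enum_uniq// cos0 mul1r big_enum.
under eq_bitavg => x.
  under eq_bigr do rewrite addrC.
  rewrite bigA_distr /=.
  under eq_bigr => H _.
    rewrite (_ : \prod_i _ = (\prod_i (if i \in H then z else 1 - z)) *
      \prod_(e in H) cos (z * corr side D x (leftv e.1) (rightv e.2))); last first.
      rewrite [X in _ * X]big_mkcond -big_split /=; apply: eq_bigr => e _.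
      by case: ifP => _; rewrite ?mulr1.
    over.
  over.
rewrite bitavg_sum.
apply: (@le_trans _ _ (\sum_(H in {set 'I_b * 'I_b})
   \prod_i (if i \in H then z * expR (- y) else 1 - z))).
  apply: ler_sum => H _; rewrite bitavgZ.
  apply: le_trans (ler_wpM2l _ (step H)) _.
    by apply: prodr_ge0 => e _; case: ifP => _; lra.
  rewrite -prodr_const [X in _ * X]big_mkcond -big_split /=.
  by apply: ler_prod => e _; case: ifP => _; rewrite ?mulr1 lexx andbT ?mulr_ge0 ?expR_ge0; lra.
rewrite -bigA_distr /= prodr_const card_prod card_ord.
have y0 : 0 <= y by rewrite /y !mulr_ge0//; lra.
have yz : y <= z / 2.
  have : 0 <= z * (1 - z) by rewrite mulr_ge0; lra.
  have : 0 <= z * z by rewrite mulr_ge0; lra.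
  by rewrite /y; nra.
have l1 : 0 <= z * expR (- y) + (1 - z) by rewrite addr_ge0 ?mulr_ge0 ?expR_ge0//; lra.
(* By [expR (- y) <= 1 - y + y ^+ 2 / 2] and [y <= z / 2], the quadratic term costs less than the
   factor [1 - z]; and [z * y * (1 - z)] is the claimed exponent. *)
have l2 : z * expR (- y) + (1 - z) <= expR (- (z ^+ 3 / 2 * (1 - z) ^+ 2)).
  apply: le_trans (expR_ge1Dx _).
  have e2 := expRN_le2 R y y0.
  have : z * expR (- y) <= z * (1 - y + y ^+ 2 / 2) by rewrite ler_pM2l.
  have : y * (z / 2 - y) >= 0 by rewrite mulr_ge0; lra.
  have -> : z ^+ 3 / 2 * (1 - z) ^+ 2 = z * (y * (1 - z)) by rewrite /y; field.
  have : 0 <= y * z by rewrite mulr_ge0; lra.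
  nra.
apply: (@le_trans _ _ (expR (- (z ^+ 3 / 2 * (1 - z) ^+ 2)) ^+ (b * b))).
  by rewrite lerXn2r// nnegrE expR_ge0.
by rewrite -expRM_natl ler_expR natrM; nra.
Qed.

End Block.
End RandomVectors.

(** * Lower bounds for the normalisation of the edge weights *)

Section LogisticWeight.
Variable R : realType.

(* Normalisation of the logistic edge weights: an edge with correlation [s] is
   red with probability [p * expR (- ((1 - p) * h * s)) / normF p h s]. *)
Definition normF (p h s : R) : R :=
  p * expR (- ((1 - p) * h * s)) + (1 - p) * expR (p * h * s).

Lemma normF_ge1 p h s : 0 < p < 1 -> 1 <= normF p h s.
Proof.
move=> /andP[p0 p1].
have e1 := expR_ge1Dx (- ((1 - p) * h * s)).
have e2 := expR_ge1Dx (p * h * s).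
have q0 : 0 <= 1 - p by rewrite subr_ge0 ltW.
have := ler_wpM2l (ltW p0) e1; have := ler_wpM2l q0 e2.
rewrite /normF; lra.
Qed.

Lemma ln_normF_ge0 p h s : 0 < p < 1 -> 0 <= ln (normF p h s).
Proof. by move=> p01; exact: ln_ge0 (normF_ge1 p h s p01). Qed.

(** With the cutoff [S = 2 / z] below, the last condition says [h * S <= z], so that the exponents
    in [normF] are small up to the cutoff. *)
Definition logistic_params (p h z : R) : Prop :=
  [/\ 0 < p < 1, 0 < h, 0 < z <= 4^-1 & 2 * h <= z ^+ 2].

Variables p h z : R.

Local Notation lam := (p * (1 - p) * h ^+ 2 / 2).
Local Notation S := (2 / z).

(** In the third-order Taylor bounds of the two exponentials the linear terms cancel and the
    quadratic ones add up to [lam * s ^+ 2]. The cubic remainder is smaller by a factor of order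
    [|h * s| <= z]. *)
Lemma normF_ge_small s : logistic_params p h z -> `|s| <= S -> 1 + lam * s ^+ 2 * (1 - z / 3) <= normF p h s.
Proof.
move=> [/andP[p0 p1] h0 /andP[z0 z4] hz] sS.
have pq0 : 0 < p * (1 - p) by rewrite mulr_gt0// subr_gt0.
have hS : h * S <= z by rewrite mulrA ler_pdivrMr// mulrC -expr2.
have e1 := expR_ge3 R (- ((1 - p) * h * s)).
have e2 := expR_ge3 R (p * h * s).
have q0 : 0 <= 1 - p by rewrite subr_ge0 ltW.
have F3 : 1 + lam * s ^+ 2 + p * (1 - p) * (2 * p - 1) * (h * s) ^+ 3 / 6 <= normF p h s.
  have := ler_wpM2l (ltW p0) e1; have := ler_wpM2l q0 e2; rewrite /normF; lra.
apply: le_trans F3.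
have hs : `|h * s| <= z.
  rewrite normrM (gtr0_norm h0); apply: le_trans hS.
  by rewrite ler_pM2l.
have c3 : `|(2 * p - 1) * (h * s) ^+ 3| <= z * (h * s) ^+ 2.
  rewrite normrM normrX.
  have n1 : `|2 * p - 1| <= 1 by rewrite ler_norml; lra.
  rewrite -(real_normK (num_real (h * s))) exprSr.
  have n0 := normr_ge0 (h * s).
  apply: (@le_trans _ _ (1 * (`|h * s| ^+ 2 * `|h * s|))).
    by apply: ler_wpM2r n1; rewrite mulr_ge0// exprn_ge0.
  by rewrite mul1r mulrC ler_wpM2r// exprn_ge0.
have c3' : - (z * (h * s) ^+ 2) <= (2 * p - 1) * (h * s) ^+ 3 by move: c3; rewrite ler_norml => /andP[].
have := ler_wpM2l (ltW pq0) c3'; lra.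
Qed.

Lemma lam_S : logistic_params p h z -> lam * S ^+ 2 <= z / 8.
Proof.
move=> [/andP[p0 p1] h0 /andP[z0 z4] hz].
have pq0 : 0 < p * (1 - p) by rewrite mulr_gt0// subr_gt0.
have pq4 : p * (1 - p) <= 4^-1 by have := sqr_ge0 (p - 2^-1); lra.
have hS : h * S <= z by rewrite mulrA ler_pdivrMr// mulrC -expr2.
have -> : lam * S ^+ 2 = p * (1 - p) * (h * S) ^+ 2 / 2 by field; lra.
have hS0 : 0 <= h * S by rewrite mulr_ge0 ?divr_ge0// ltW.
have : (h * S) ^+ 2 <= z ^+ 2 by rewrite lerXn2r// nnegrE// ltW.
have : z ^+ 2 <= z * 4^-1 by rewrite expr2 ler_pM2l.
have := sqr_ge0 (h * S); nra.
Qed.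

Lemma ln_normF_ge_small s : logistic_params p h z -> `|s| <= S -> lam * (1 - z) * s ^+ 2 <= ln (normF p h s).
Proof.
move=> prm sS; have F := normF_ge_small s prm sS; have lS := lam_S prm.
case: prm => /andP[p0 p1] h0 /andP[z0 z4] hz.
have pq0 : 0 < p * (1 - p) by rewrite mulr_gt0// subr_gt0.
set Z := lam * s ^+ 2 * (1 - z / 3) in F.
have l0 : 0 <= lam by rewrite divr_ge0// mulr_ge0 ?sqr_ge0// ltW.
have ls0 : 0 <= lam * s ^+ 2 by rewrite mulr_ge0// sqr_ge0.
have Z0 : 0 <= Z by rewrite /Z mulr_ge0//; lra.
have s2 : s ^+ 2 <= S ^+ 2.
  by rewrite -(real_normK (num_real s)) lerXn2r// nnegrE ?normr_ge0// divr_ge0// ltW.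
have Z8 : Z <= z / 8.
  have := ler_wpM2l l0 s2; move: lS; rewrite /Z; nra.
have lnF : ln (1 + Z) <= ln (normF p h s) by rewrite ler_ln// posrE; lra.
apply: le_trans lnF.
have := ln1D_ge4 R Z Z0.
have Z3 : Z ^+ 4 <= Z ^+ 3.
  by rewrite exprS -[leRHS]mul1r ler_wpM2r ?exprn_ge0//; lra.
have := exprn_ge0 3 Z0.
have : lam * (1 - z) * s ^+ 2 <= Z - Z ^+ 2 / 2.
  have -> : Z - Z ^+ 2 / 2 = lam * s ^+ 2 * ((1 - z / 3) * (1 - Z / 2)) by rewrite /Z; ring.
  rewrite mulrAC ler_wpM2l//; nra.
lra.
Qed.

(** [normF] is convex in [s] with its minimum at [0]. The proof uses the tangent lines of the two
    exponentials at the cutoff point [s0] on the same side as [s]. *)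
Lemma normF_mono s : logistic_params p h z -> S <= `|s| -> normF p h (Num.sg s * S) <= normF p h s.
Proof.
move=> [/andP[p0 p1] h0 /andP[z0 z4] hz] Ss.
have pq0 : 0 < p * (1 - p) by rewrite mulr_gt0// subr_gt0.
set s0 := Num.sg s * S; set d := s - s0.
have S0 : 0 < S by rewrite divr_gt0.
have -> : normF p h s = p * expR (- ((1 - p) * h * s0)) * expR (- ((1 - p) * h * d)) +
    (1 - p) * expR (p * h * s0) * expR (p * h * d).
  by rewrite -!mulrA -!expRD /normF; congr (_ * expR _ + _ * expR _); rewrite /d; ring.
have e1 := expR_ge1Dx (- ((1 - p) * h * d)).
have e2 := expR_ge1Dx (p * h * d).
have q0 : 0 < 1 - p by rewrite subr_gt0.
have := ler_wpM2l (ltW (mulr_gt0 p0 (expR_gt0 (- ((1 - p) * h * s0))))) e1.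
have := ler_wpM2l (ltW (mulr_gt0 q0 (expR_gt0 (p * h * s0)))) e2.
suff : 0 <= p * (1 - p) * h * (d * (expR (p * h * s0) - expR (- ((1 - p) * h * s0)))).
  rewrite /normF; lra.
rewrite mulr_ge0//; first by rewrite mulr_ge0// ltW.
have [s_gt0|s_lt0|s_eq0] := ltrgt0P s.
- move: Ss; rewrite gtr0_norm// => Ss.
  rewrite /d /s0 gtr0_sg// mul1r mulr_ge0 ?subr_ge0// ler_expR.
  have : 0 <= h * S by rewrite mulr_ge0// ltW.
  have -> : p * h * S = p * (h * S) by ring.
  have -> : (1 - p) * h * S = (1 - p) * (h * S) by ring.
  nra.
- move: Ss; rewrite ltr0_norm// => Ss.
  rewrite /d /s0 ltr0_sg// mulN1r -mulrNN mulr_ge0//; first by lra.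
  rewrite opprB subr_ge0 ler_expR.
  have : 0 <= h * S by rewrite mulr_ge0// ltW.
  have -> : p * h * - S = - (p * (h * S)) by ring.
  have -> : (1 - p) * h * - S = - ((1 - p) * (h * S)) by ring.
  nra.
- by move: Ss; rewrite s_eq0 normr0; lra.
Qed.

(** This prepares Hoelder with exponent [w], one share per round: the [z^-1] power of the
    normalisation is dominated by the [w]-th root of a factor that [block_bound] can average. *)
Lemma ln_normF_ge_cos (w : nat) s : logistic_params p h z -> (0 < w)%N ->
  z ^+ 4 <= 2 * w%:R * lam * (1 - z) * (1 - 2 * z) ->
  - (z^-1 * ln (normF p h s)) <= w%:R^-1 * ln (1 - z + z * cos (z * s)).
Proof.
move=> prm w0 hw; case: (prm) => /andP[p0 p1] h0 /andP[z0 z4] hz.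
have p01 : 0 < p < 1 by rewrite p0.
have wp : 0 < w%:R :> R by rewrite ltr0n.
set t := z * (1 - cos (z * s)).
have t0 : 0 <= t by rewrite mulr_ge0 ?(ltW z0)// subr_ge0 cos_le1.
have t2 : t <= 2 * z.
  by rewrite /t mulrC ler_pM2r//; have := cos_geN1 (z * s); lra.
have S0 : 0 < S by rewrite divr_gt0.
(* [M] is the smaller of [s ^+ 2] and [S ^+ 2]. Below the cutoff both sides are quadratic in [s];
   beyond it [t] is at most [2 * z], the value of [z ^+ 3 / 2 * S ^+ 2], while [normF] keeps
   growing. *)
have [M [tM FM]] : exists M, t <= z ^+ 3 / 2 * M /\ lam * (1 - z) * M <= ln (normF p h s).
  have [sS|/ltW Ss] := leP `|s| S.
    exists (s ^+ 2); split; last exact: ln_normF_ge_small.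
    have /andP[c _] := cos_bounds R (z * s).
    have -> : z ^+ 3 / 2 * s ^+ 2 = z * ((z * s) ^+ 2 / 2) by ring.
    by rewrite ler_pM2l//; lra.
  exists (S ^+ 2); split.
    by have -> : z ^+ 3 / 2 * S ^+ 2 = 2 * z by field; lra.
  have sg1 : `|Num.sg s * S| = S.
    rewrite normrM normr_sg (gtr0_norm S0) (_ : s != 0) ?mul1r//.
    by rewrite -normr_gt0 (lt_le_trans S0).
  have := ln_normF_ge_small (Num.sg s * S) prm; rewrite sg1 lexx => /(_ isT).
  rewrite -(real_normK (num_real (_ * S))) sg1 => H; apply: le_trans H _.
  have F1 := normF_ge1 p h (Num.sg s * S) p01.
  by rewrite ler_ln ?normF_mono// posrE; have := normF_ge1 p h s p01; lra.
have l1 : - ln (1 - t) <= t / (1 - 2 * z).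
  have := le_ln1Dx (x := (1 - t)^-1 - 1).
  have t1 : 0 < 1 - t by lra.
  rewrite subrKC lnV ?posrE// => H.
  apply: le_trans (H _) _; first by have := invr_gt0 (1 - t); lra.
  rewrite ler_pdivlMr; last by lra.
  have -> : (1 - t)^-1 - 1 = t / (1 - t) by field; lra.
  by rewrite mulrAC ler_pdivrMr// ler_wpM2l//; lra.
have -> : 1 - z + z * cos (z * s) = 1 - t by rewrite /t; ring.
have z2 : 0 < 1 - 2 * z by lra.
have l2 : - ln (1 - t) <= z ^+ 3 / 2 * M / (1 - 2 * z).
  by apply: le_trans l1 _; rewrite ler_pM2r// invr_gt0.
have M0 : 0 <= M.
  have : 0 < z ^+ 3 / 2 by rewrite divr_gt0// exprn_gt0.
  by move: (le_trans t0 tM); nra.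
suff : w%:R^-1 * - ln (1 - t) <= z^-1 * ln (normF p h s) by lra.
apply: le_trans (ler_wpM2l _ l2) _; first by rewrite invr_ge0 ltW.
apply: (@le_trans _ _ (z^-1 * (lam * (1 - z) * M))); last by rewrite ler_pM2l// invr_gt0.
rewrite ler_pdivrMl// mulrCA ler_pdivlMl// mulrA ler_pdivrMr//.
have := ler_wpM2r M0 hw; lra.
Qed.

End LogisticWeight.

(** * Exponential moments of the sum of correlations in a clique *)

Section CliqueAverages.
Variable R : realType.

Lemma sum_neq_sym (n : nat) (T : 'I_n -> 'I_n -> R) : (forall a b, T a b = T b a) ->
  \sum_(a < n) \sum_(b < n | b != a) T a b =
  2 * \sum_(a < n) \sum_(b < n | (a < b)%N) T a b.
Proof.
move=> Ts; rewrite mulr_natl mulr2n.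
rewrite [X in _ + X](exchange_big_dep xpredT)//= -big_split /=; apply: eq_bigr => a _.
rewrite (bigID (fun b : 'I_n => (a < b)%N)) /=; congr (_ + _).
  by apply: eq_bigl => b; rewrite andb_idl// => ab; rewrite -(inj_eq val_inj) gtn_eqF.
apply: eq_big => [b|b _]; last exact: Ts.
by rewrite -(inj_eq val_inj) -leqNgt ltn_neqAle.
Qed.

Section Linear.
Variables (V : finType) (D : nat).
Local Notation bits := (V * 'I_(D ^ 2))%type.

(** In each coordinate the sum over all ordered pairs is the square of the sum of signs; the
    diagonal pairs contribute [#|V|]. *)
Lemma sum_corr_neq (x : {ffun bits -> bool}) : (0 < D)%N ->
  \sum_u \sum_(v | v != u) corr R V D x u v =
  \sum_c (signsum R V (fun=> 1) (index_enum V) (restr _ _ (coord V D c) x) ^+ 2 - #|V|%:R) / D%:R.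
Proof.
move=> D0.
transitivity (\sum_u \sum_v corr R V D x u v - \sum_u corr R V D x u u).
  rewrite -sumrB; apply: eq_bigr => u _; rewrite [in RHS](bigD1 u)//=; ring.
rewrite -mulr_suml; rewrite /corr -mulr_suml.
under eq_bigr => u _ do rewrite -mulr_suml.
rewrite -mulr_suml -mulrBl; congr (_ / _).
under eq_bigr => u _ do rewrite exchange_big.
rewrite exchange_big /= [X in _ - X]exchange_big /= -sumrB.
apply: eq_bigr => c _; congr (_ - _).
  rewrite expr2 /signsum mulr_suml; apply: eq_bigr => u _.
  by rewrite mulr_sumr; apply: eq_bigr => v _; rewrite !ffunE !mulr1.
by under eq_bigr do rewrite -expr2 sqrr_sign; rewrite sumr_const.
Qed.

Lemma bitavg_expR_sum_corr (a : R) : (0 < D)%N ->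
  bitavg R bits (fun x => expR (a * ((\sum_u \sum_(v | v != u) corr R V D x u v) / 2))) =
  (expR (- (a / (2 * D%:R) * #|V|%:R)) *
   bitavg R V (fun y => expR (a / (2 * D%:R) * signsum R V (fun=> 1) (index_enum V) y ^+ 2))) ^+ (D ^ 2).
Proof.
move=> D0; have Dp : 0 < D%:R :> R by rewrite ltr0n.
rewrite -bitavgZ -bitavg_prod_coord; apply: eq_bitavg => x.
under [RHS]eq_bigr do rewrite -expRD.
rewrite -expR_sum sum_corr_neq// mulr_suml mulr_sumr; congr expR.
by apply: eq_bigr => c _; field; rewrite gt_eqF.
Qed.

Lemma size_index_enum : size (index_enum V) = #|V|.
Proof. by rewrite cardT enumT. Qed.

(** Per coordinate the exponent is [- th / 2 - ln (1 - th) / 2]: the diagonal cancels the linear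
    term of the logarithm, leaving the second-order term [th ^+ 2 / 4] and the triangle term
    [th ^+ 3 / 6]. *)
Lemma bitavg_expR_corr_pos (a : R) : (0 < D)%N -> 0 <= a ->
  let th := a * #|V|%:R / D%:R in th <= 2^-1 ->
  bitavg R bits (fun x => expR (a * ((\sum_u \sum_(v | v != u) corr R V D x u v) / 2))) <=
  expR (D%:R ^+ 2 * (th ^+ 2 / 4 + th ^+ 3 / 6 + th ^+ 4 / 4)).
Proof.
move=> D0 a0 th th2; have Dp : 0 < D%:R :> R by rewrite ltr0n.
have th0 : 0 <= th by rewrite divr_ge0 ?mulr_ge0// ltW.
rewrite bitavg_expR_sum_corr//.
have th_e : 2 * (a / (2 * D%:R)) * (size (index_enum V))%:R = th.
  by rewrite size_index_enum /th; field; rewrite gt_eqF.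
have := bitavg_expR_signsum_sqr R V (a / (2 * D%:R)) _ (index_enum_uniq _).
rewrite th_e => H; rewrite -natrX expRM_natl lerXn2r// ?nnegrE ?expR_ge0//.
  by apply: mulr_ge0; [exact: expR_ge0|apply: bitavg_ge0 => x; exact: expR_ge0].
apply: le_trans (ler_wpM2l _ (H _ _)) _; first exact: expR_ge0.
- by rewrite divr_ge0// mulr_ge0// ltW.
- lra.
rewrite -expRD ler_expR.
have -> : a / (2 * D%:R) * #|V|%:R = th / 2 by rewrite /th; field; rewrite gt_eqF.
by have := ln1B_le4 R th th0 th2; lra.
Qed.

(** As above with [th] negated, so the triangle term changes sign. The summand [th ^+ 2 / #|V|%:R]
    is the accumulated error of [bitavg_expRN_signsum_sqr]. *)
Lemma bitavg_expR_corr_neg (a : R) : (0 < D)%N -> 0 <= a ->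
  let th := a * #|V|%:R / D%:R in a / (2 * D%:R) <= 4^-1 -> (0 < #|V|)%N ->
  bitavg R bits (fun x => expR (- a * ((\sum_u \sum_(v | v != u) corr R V D x u v) / 2))) <=
  expR (D%:R ^+ 2 * (th ^+ 2 / 4 - th ^+ 3 / 6 + th ^+ 4 / 8 + th ^+ 2 / #|V|%:R)).
Proof.
move=> D0 a0 th a4 V0; have Dp : 0 < D%:R :> R by rewrite ltr0n.
have Vp : 0 < #|V|%:R :> R by rewrite ltr0n.
have th0 : 0 <= th by rewrite divr_ge0 ?mulr_ge0// ltW.
rewrite bitavg_expR_sum_corr//.
have th_e : 2 * (a / (2 * D%:R)) * (size (index_enum V))%:R = th.
  by rewrite size_index_enum /th; field; rewrite gt_eqF.
have := bitavg_expRN_signsum_sqr R V (a / (2 * D%:R)) _ (index_enum_uniq _).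
rewrite th_e => H; rewrite -natrX expRM_natl lerXn2r// ?nnegrE ?expR_ge0//.
  by apply: mulr_ge0; [exact: expR_ge0|apply: bitavg_ge0 => x; exact: expR_ge0].
under eq_bitavg do rewrite !mulNr.
apply: le_trans (ler_wpM2l _ (H _ _)) _; first exact: expR_ge0.
- by rewrite divr_ge0// mulr_ge0// ltW.
- exact: a4.
rewrite -expRD ler_expR size_index_enum.
have -> : - (- a / (2 * D%:R) * #|V|%:R) = th / 2 by rewrite /th; field; rewrite gt_eqF.
have -> : 4 * #|V|%:R * (a / (2 * D%:R)) ^+ 2 = th ^+ 2 / #|V|%:R.
  by rewrite /th; field; rewrite !gt_eqF.
by have := ln1D_ge4 R th th0; lra.
Qed.

End Linear.
End CliqueAverages.

(** * Round-robin tournament of the vertex groups *)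

Section Rounds.
Variable R : realType.

Definition lift_vertex (V V' : finType) (D : nat) (g : V' -> V) (k : V' * 'I_(D ^ 2)) :
  V * 'I_(D ^ 2) := (g k.1, k.2).

Lemma lift_vertex_inj V V' D g : injective g -> injective (lift_vertex V V' D g).
Proof. by move=> gi [u c] [v d] [/gi -> ->]. Qed.

Lemma corr_lift V V' D g x u v :
  corr R V' D (restr _ _ (lift_vertex V V' D g) x) u v = corr R V D x (g u) (g v).
Proof. by congr (_ / _); apply: eq_bigr => c _; rewrite !ffunE. Qed.

Variables (w0 b D : nat).
Local Notation w := w0.+1.
Local Notation V := ('I_w * 'I_b)%type.
Local Notation bits := (V * 'I_(D ^ 2))%type.

(** Subtraction is modulo [w]: round [k] matches group [a] with group [k - a], and the strict
    inequality selects each match once and excludes [a = k - a]. *)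
Definition in_round (k a : 'I_w) : bool := (a < (k - a)%R)%N.

(** The groups [a] and [a'] meet exactly in the round [k = a + a'] modulo [w]. *)
Lemma sum_rounds (T : 'I_w -> 'I_w -> R) :
  \sum_(a < w) \sum_(a' < w | (a < a')%N) T a a' =
  \sum_(k < w) \sum_(a < w | in_round k a) T a (k - a).
Proof.
rewrite [RHS](exchange_big_dep xpredT)//=; apply: eq_bigr => a _.
by rewrite (reindex_inj (@subIr _ a)).
Qed.

(** Pairs inside one group are discarded, which only decreases a sum of nonnegative terms. *)
Lemma sum_groups (L : V -> V -> R) : (forall u v, 0 <= L u v) ->
  \sum_(a < w) \sum_(a' < w | a' != a) \sum_(e : 'I_b * 'I_b) L (a, e.1) (a', e.2) <=
  \sum_u \sum_(v | v != u) L u v.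
Proof.
move=> L0.
apply: (@le_trans _ _ (\sum_u \sum_v (if v.1 != u.1 then L u v else 0))); last first.
  apply: ler_sum => u _; rewrite [leRHS]big_mkcond; apply: ler_sum => v _ /=.
  case: (eqVneq v u) => [->|_]; first by rewrite eqxx.
  by case: ifP => _ /=; rewrite ?lexx ?L0.
rewrite [leRHS](_ : _ = \sum_a \sum_i \sum_(a' < w) \sum_j
    (if a' != a then L (a, i) (a', j) else 0)); last first.
  rewrite [RHS]pair_bigA /=; apply: eq_bigr => -[a i] _.
  by rewrite [RHS]pair_bigA /=; apply: eq_bigr => -[].
apply: ler_sum => a _.
rewrite [leRHS]exchange_big /= [leLHS]big_mkcond /=; apply: ler_sum => a' _.
case: ifP => _; last by rewrite !big1// => i _; rewrite big1.
by rewrite [leRHS]pair_bigA.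
Qed.

Definition round_vertex (k a : 'I_w) (s : bool * 'I_b) : V :=
  (if s.1 then k - a else a, s.2).

(* Within a round the group pairs are vertex-disjoint, hence independent. *)
Lemma round_bound (z : R) (k : 'I_w) : 0 < z -> z <= 4^-1 -> (0 < D)%N ->
  z ^+ 2 * b%:R ^+ 2 / D%:R ^+ 2 <= z ->
  bitavg R bits (fun x => expR (\sum_(a < w | in_round k a) \sum_(e : 'I_b * 'I_b)
    ln (1 - z + z * cos (z * corr R V D x (a, e.1) (k - a, e.2))))) <=
  expR (- (z ^+ 3 / 2 * (1 - z) ^+ 2 * b%:R ^+ 2 *
    \sum_(a < w | in_round k a) 1)).
Proof.
move=> z0 z4 D0 vz.
pose f (y : {ffun (bool * 'I_b) * 'I_(D ^ 2) -> bool}) : R := \prod_(e : 'I_b * 'I_b)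
    (1 - z + z * cos (z * corr R _ D y (leftv b e.1) (rightv b e.2))).
pose r := [seq a <- index_enum 'I_w | in_round k a].
have rP a : a \in r -> in_round k a by rewrite mem_filter => /andP[].
have e x : expR (\sum_(a < w | in_round k a) \sum_(e : 'I_b * 'I_b)
    ln (1 - z + z * cos (z * corr R V D x (a, e.1) (k - a, e.2)))) =
    \prod_(a <- r) f (restr _ _ (lift_vertex V _ D (round_vertex k a)) x).
  rewrite expR_sum big_filter; apply: eq_bigr => a _.
  rewrite expR_sum; apply: eq_bigr => e _; rewrite lnK ?corr_lift// posrE.
  by have := cos_geN1 (z * corr R V D x (a, e.1) (k - a, e.2)); nra.
under eq_bitavg do rewrite e.
rewrite (bitavg_prod_indep _ _ _ _ _ (fun=> f)).
- rewrite big_filter mulr_sumr -sumrN expR_sum; apply: ler_prod => a _; apply/andP; split.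
    apply: bitavg_ge0 => x; apply: prodr_ge0 => -[i j] _.
    by have := cos_geN1 (z * corr R _ D x (leftv b (i, j).1) (rightv b (i, j).2)); nra.
  by rewrite mulr1; apply: block_bound => //; lra.
- by rewrite filter_uniq ?index_enum_uniq.
- move=> a /rP ak; have ka : k - a <> a by move=> ea; move: ak; rewrite /in_round ea ltnn.
  apply: lift_vertex_inj => -[s i] [s' i'] [] ss ->; congr (_, _).
  by case: s s' ss => -[]//= e0; case: ka.
(* Two different matches of a round could share a group only if [a' = k - a]; then [in_round] would
   give both [a < a'] and [a' < a]. *)
- move=> a a' [[s i] c] [[s' i'] c'] /rP ak /rP ak' [] ss _ _.
  case: s s' ss => -[]//= e0; first by apply/eqP; rewrite -(inj_eq (subrI k)) e0.
    by move: ak ak'; rewrite /in_round -e0 subKr => /ltn_trans /[apply]; rewrite ltnn.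
  by move: ak ak'; rewrite /in_round e0 subKr => /ltn_trans /[apply]; rewrite ltnn.
Qed.

(** Hoelder with equal weights [w%:R^-1] over the [w] rounds. There are [w * w0 / 2] matches in all,
    so a round contributes [w0 / 2] blocks on average. *)
Lemma quad_bound (p h z : R) : logistic_params R p h z -> (0 < D)%N ->
  z ^+ 2 * b%:R ^+ 2 / D%:R ^+ 2 <= z ->
  z ^+ 4 <= 2 * w%:R * (p * (1 - p) * h ^+ 2 / 2) * (1 - z) * (1 - 2 * z) ->
  bitavg R bits (fun x => expR (- (z^-1 *
    ((\sum_u \sum_(v | v != u) ln (normF R p h (corr R V D x u v))) / 2)))) <=
  expR (- (z ^+ 3 / 2 * (1 - z) ^+ 2 * b%:R ^+ 2 * (w0%:R / 2))).
Proof.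
move=> prm D0 vz hw; case: (prm) => p01 _ /andP[z0 z4] _.
have wp : 0 < w%:R :> R by rewrite ltr0n.
pose phi k x := \sum_(a < w | in_round k a) \sum_(e : 'I_b * 'I_b)
    ln (1 - z + z * cos (z * corr R V D x (a, e.1) (k - a, e.2))).
apply: (@le_trans _ _ (bitavg R bits (fun x => expR (\sum_(k < w) w%:R^-1 * phi k x)))).
  apply: bitavg_le => x; rewrite ler_expR.
  pose L u v := ln (normF R p h (corr R V D x u v)).
  pose T a a' := \sum_(e : 'I_b * 'I_b) L (a, e.1) (a', e.2).
  have L0 u v : 0 <= L u v by exact: ln_normF_ge0.
  have Ts a a' : T a a' = T a' a.
    rewrite /T -(pair_bigA _ (fun i j => L (a, i) (a', j))) exchange_big /=.
    rewrite -(pair_bigA _ (fun i j => L (a', i) (a, j))) /=.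
    by apply: eq_bigr => i _; apply: eq_bigr => j _; rewrite /L corrC.
  have := sum_groups L L0; rewrite (sum_neq_sym _ _ T)// sum_rounds => H.
  apply: (@le_trans _ _ (- (z^-1 * \sum_(k < w) \sum_(a < w | in_round k a) T a (k - a)))).
    by rewrite lerN2 ler_pM2l ?invr_gt0// ler_pdivlMr// mulrC.
  rewrite mulr_sumr -sumrN; apply: ler_sum => k _.
  rewrite /phi [X in - X]mulr_sumr [leRHS]mulr_sumr -sumrN; apply: ler_sum => a _.
  rewrite /T [X in - X]mulr_sumr [leRHS]mulr_sumr -sumrN; apply: ler_sum => e _.
  exact: ln_normF_ge_cos.
apply: le_trans (bitavg_holder _ _ _ _ _ _ _ _ (fun k => round_bound z k z0 z4 D0 vz)) _.
- by move=> k; rewrite invr_ge0 ltW.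
- by rewrite sumr_const card_ord -[_ *+ _]mulr_natl mulfV// gt_eqF.
rewrite ler_expR -mulr_sumr sumrN -mulr_sumr -(sum_rounds (fun _ _ => 1)).
have -> : \sum_(a < w) \sum_(a' < w | (a < a')%N) 1 = w%:R * w0%:R / 2 :> R.
  have := sum_neq_sym R w (fun _ _ => 1) (fun _ _ => erefl).
  under eq_bigr => a _.
    rewrite sumr_const (_ : #|_| = w0); last by have := cardC1 a; rewrite card_ord.
    over.
  rewrite sumr_const card_ord -[_ *+ w]mulr_natl; lra.
rewrite le_eqVlt; apply/orP; left; apply/eqP; field.
by rewrite gt_eqF.
Qed.

End Rounds.

(** * Expected weight of red and blue cliques *)

Section CliqueBounds.
Variable R : realType.

Definition redw (p h s : R) : R := p * expR (- ((1 - p) * h * s)) / normF R p h s.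
Definition bluew (p h s : R) : R := (1 - p) * expR (p * h * s) / normF R p h s.

Section Weights.
Variables p h s : R.

Lemma normF_gt0 : 0 < p < 1 -> 0 < normF R p h s.
Proof. by move=> p01; apply: lt_le_trans (normF_ge1 R p h s p01). Qed.

Lemma redw_gt0 : 0 < p < 1 -> 0 < redw p h s.
Proof.
move=> p01; rewrite divr_gt0 ?normF_gt0// mulr_gt0 ?expR_gt0//.
by case/andP: p01.
Qed.

Lemma bluew_gt0 : 0 < p < 1 -> 0 < bluew p h s.
Proof.
move=> p01; rewrite divr_gt0 ?normF_gt0// mulr_gt0 ?expR_gt0// subr_gt0.
by case/andP: p01.
Qed.

Lemma redwDbluew : 0 < p < 1 -> redw p h s + bluew p h s = 1.
Proof. by move=> p01; rewrite -mulrDl divff// gt_eqF// normF_gt0. Qed.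

Lemma ln_redw : 0 < p < 1 -> ln (redw p h s) = ln p + - ((1 - p) * h) * s - ln (normF R p h s).
Proof.
move=> p01; have /andP[p0 _] := p01.
by rewrite ln_div ?posrE ?mulr_gt0 ?expR_gt0 ?normF_gt0// lnM ?posrE ?expR_gt0// expRK mulNr.
Qed.

Lemma ln_bluew : 0 < p < 1 -> ln (bluew p h s) = ln (1 - p) + p * h * s - ln (normF R p h s).
Proof.
move=> p01; have /andP[_ p1] := p01.
by rewrite ln_div ?posrE ?mulr_gt0 ?subr_gt0 ?expR_gt0 ?normF_gt0// lnM ?posrE ?subr_gt0 ?expR_gt0// expRK.
Qed.

End Weights.

Variables (w0 b D : nat).
Local Notation w := w0.+1.
Local Notation V := ('I_w * 'I_b)%type.
Local Notation bits := (V * 'I_(D ^ 2))%type.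
Local Notation m := (#|{: V}|%:R : R).

(* [w] is, up to a factor [1 - z], the number of rounds at which the exponents
   of the Hoelder inequality match the curvature of [ln normF]. *)
Definition round_params (p h z : R) : Prop :=
  [/\ logistic_params R p h z, ((0 < D) && (0 < b))%N, z ^+ 2 * b%:R ^+ 2 / D%:R ^+ 2 <= z,
      2 * w%:R * (p * (1 - p) * h ^+ 2 / 2) * (1 - z) ^+ 2 * (1 - 2 * z) <= z ^+ 4 <=
      2 * w%:R * (p * (1 - p) * h ^+ 2 / 2) * (1 - z) * (1 - 2 * z)
    & w%:R * (1 - z) <= w0%:R].

Lemma card_groups : #|{: V}| = (w * b)%N.
Proof. by rewrite card_prod !card_ord. Qed.

Lemma sum_neq_cst (c : R) : \sum_(u : V) \sum_(v | v != u) c = (m ^+ 2 - m) * c.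
Proof.
transitivity (\sum_(u : V) (m * c - c)).
  apply: eq_bigr => u _.
  have -> : m * c = \sum_(v : V) c by rewrite sumr_const mulr_natl.
  by rewrite [in RHS](bigD1 u)//= [c + _]addrC addrK.
by rewrite sumr_const -[_ *+ _]mulr_natl; ring.
Qed.

(** Hoelder with two factors: weight [1 - z] for the exponentials linear in the correlations, which
    explains [a / (1 - z)], and weight [z] for the normalisations, treated by [quad_bound]. *)
Lemma clique_avg (p h z lA a L : R) : round_params p h z ->
  bitavg R bits (fun x => expR (a / (1 - z) *
    ((\sum_u \sum_(v | v != u) corr R V D x u v) / 2))) <= expR L ->
  bitavg R bits (fun x => expR ((\sum_u \sum_(v | v != u)
    (lA + a * corr R V D x u v - ln (normF R p h (corr R V D x u v)))) / 2)) <=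
  expR ((m ^+ 2 - m) / 2 * lA + (1 - z) * L
    - p * (1 - p) * h ^+ 2 / 2 * (1 - 7 * z) * (m ^+ 2 / 2)).
Proof.
move=> [prm /andP[D0 b0] vz /andP[hw' hw] wz] HL; have [p01 h0 /andP[z0 z4] _] := prm.
have /andP[p0 p1] := p01.
have z1 : 0 < 1 - z by lra.
have Q := quad_bound R w0 b D p h z prm D0 vz hw.
set L1 := - (z ^+ 3 / 2 * (1 - z) ^+ 2 * b%:R ^+ 2 * (w0%:R / 2)) in Q.
pose c (t : bool) := if t then 1 - z else z.
pose phi (t : bool) x := if t then a / (1 - z) *
    ((\sum_u \sum_(v | v != u) corr R V D x u v) / 2) else
  - (z^-1 * ((\sum_u \sum_(v | v != u) ln (normF R p h (corr R V D x u v))) / 2)).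
pose LL (t : bool) := if t then L else L1.
have := bitavg_holder R bits _ c LL phi.
rewrite !big_bool /= => H.
have {}H : bitavg R bits (fun x => expR (\sum_i c i * phi i x)) <= expR ((1 - z) * L + z * L1).
  apply: H; first by case; rewrite /c; lra.
    by rewrite /c; ring.
  by case.
have e x : (\sum_u \sum_(v | v != u)
    (lA + a * corr R V D x u v - ln (normF R p h (corr R V D x u v)))) / 2 =
    (m ^+ 2 - m) / 2 * lA + \sum_i c i * phi i x.
  rewrite big_bool /c /phi /=.
  have -> : \sum_u \sum_(v | v != u)
    (lA + a * corr R V D x u v - ln (normF R p h (corr R V D x u v))) =
    (m ^+ 2 - m) * lA + a * (\sum_u \sum_(v | v != u) corr R V D x u v) -
     \sum_u \sum_(v | v != u) ln (normF R p h (corr R V D x u v)).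
    rewrite -sum_neq_cst mulr_sumr -big_split -sumrB /=; apply: eq_bigr => u _.
    by rewrite mulr_sumr -big_split -sumrB.
  by field; rewrite !gt_eqF.
under eq_bitavg do rewrite e expRD.
rewrite bitavgZ -addrA expRD ler_pM2l ?expR_gt0//; apply: le_trans H _.
rewrite ler_expR lerD2l.
have wp : 0 < w%:R :> R by rewrite ltr0n.
have w00 : 0 <= w0%:R :> R by rewrite ler0n.
set lam := p * (1 - p) * h ^+ 2 / 2 in hw hw' *.
have lam0 : 0 < lam by rewrite /lam divr_gt0// mulr_gt0 ?exprn_gt0// mulr_gt0// subr_gt0.
have -> : m = w%:R * b%:R by rewrite card_groups natrM.
have bb : 0 <= b%:R ^+ 2 :> R by rewrite sqr_ge0.
have -> : z * L1 = - (z ^+ 4 * ((1 - z) ^+ 2 * b%:R ^+ 2 * w0%:R / 4)) by rewrite /L1; field.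
rewrite lerN2.
have s1 : 0 <= (1 - z) ^+ 2 * b%:R ^+ 2 * w0%:R / 4.
  by rewrite divr_ge0// mulr_ge0// mulr_ge0// sqr_ge0.
apply: le_trans (ler_wpM2r s1 hw').
have -> : 2 * w%:R * lam * (1 - z) ^+ 2 * (1 - 2 * z) * ((1 - z) ^+ 2 * b%:R ^+ 2 * w0%:R / 4) =
  lam * ((1 - z) ^+ 4 * (1 - 2 * z)) * (w%:R * b%:R ^+ 2 * w0%:R / 2) by field.
have s2 : w%:R * b%:R ^+ 2 * (w%:R * (1 - z)) <= w%:R * b%:R ^+ 2 * w0%:R.
  by rewrite ler_wpM2l// mulr_ge0// ltW.
have s3 : 0 <= (1 - z) ^+ 4 * (1 - 2 * z) by rewrite mulr_ge0 ?exprn_ge0//; lra.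
have s4 := ler_wpM2l s3 s2.
(* Of the five factors [1 - z], two come from [block_bound], two from the lower bound on [z ^+ 4] in
   [round_params], and one from [w * (1 - z) <= w0]; [1 - 2 * z] comes from [round_params] too. *)
have s5 : 1 - 7 * z <= (1 - z) ^+ 5 * (1 - 2 * z).
  have a2 : 1 - 2 * z <= (1 - z) ^+ 2 by have := sqr_ge0 z; nra.
  have a4 : 1 - 4 * z <= (1 - z) ^+ 4.
    have -> : (1 - z) ^+ 4 = (1 - z) ^+ 2 * (1 - z) ^+ 2 by ring.
    have q1 : 0 <= (1 - z) ^+ 2 by rewrite sqr_ge0.
    by have := sqr_ge0 z; nra.
  have a5 : 1 - 5 * z <= (1 - z) ^+ 5.
    rewrite exprS; have := ler_wpM2l (ltW z1) a4; have := sqr_ge0 z; nra.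
  have : (1 - 5 * z) * (1 - 2 * z) <= (1 - z) ^+ 5 * (1 - 2 * z) by rewrite ler_wpM2r//; lra.
  have := sqr_ge0 z; nra.
have m2 : 0 <= w%:R * b%:R ^+ 2 * w%:R :> R by rewrite mulr_ge0// ?mulr_ge0// ltW.
have s6 := ler_wpM2r m2 s5.
rewrite -[leLHS]mulrA -[leRHS]mulrA ler_pM2l//.
move: s4 s6; rewrite exprS; nra.
Qed.

Lemma red_clique_avg (p h z : R) : round_params p h z ->
  let th := (1 - p) * h / (1 - z) * m / D%:R in
  (1 - p) * h / (1 - z) / (2 * D%:R) <= 4^-1 ->
  bitavg R bits (fun x => expR ((\sum_u \sum_(v | v != u)
    ln (redw p h (corr R V D x u v))) / 2)) <=
  expR (m ^+ 2 / 2 * ((1 - m^-1) * ln p +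
    (1 - p) ^+ 2 * h ^+ 2 / (1 - z) * (1 / 2 - th / 3 + th ^+ 2 / 4 + 2 / m)
    - p * (1 - p) * h ^+ 2 / 2 * (1 - 7 * z))).
Proof.
move=> rp th D4; have [prm /andP[D0 b0] vz _ _] := rp; have [p01 h0 /andP[z0 z4] _] := prm.
have /andP[p0 p1] := p01.
have z1 : 0 < 1 - z by lra.
have Vm : (0 < #|{: V}|)%N by rewrite card_groups muln_gt0.
have mp : 0 < m by rewrite ltr0n.
have Dp : 0 < D%:R :> R by rewrite ltr0n.
have a0 : 0 <= (1 - p) * h / (1 - z) by rewrite divr_ge0 ?mulr_ge0//; lra.
have := clique_avg p h z (ln p) (- ((1 - p) * h)) _ rp; rewrite mulNr.
move=> /(_ _ (bitavg_expR_corr_neg R V D _ D0 a0 D4 Vm)).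
under eq_bitavg => x.
  under eq_bigr => u _ do under eq_bigr => v _ do rewrite -ln_redw//.
  over.
move/le_trans; apply; rewrite ler_expR -/th.
rewrite le_eqVlt; apply/orP; left; apply/eqP.
have -> : D%:R ^+ 2 * (th ^+ 2 / 4 - th ^+ 3 / 6 + th ^+ 4 / 8 + th ^+ 2 / m) =
   (D%:R * th) ^+ 2 * (1 / 4 - th / 6 + th ^+ 2 / 8 + m^-1) by field; rewrite gt_eqF.
have -> : D%:R * th = (1 - p) * h / (1 - z) * m by rewrite /th; field; rewrite !gt_eqF.
by field; rewrite !gt_eqF.
Qed.

Lemma blue_clique_avg (p h z : R) : round_params p h z ->
  let th := p * h / (1 - z) * m / D%:R in th <= 2^-1 ->
  bitavg R bits (fun x => expR ((\sum_u \sum_(v | v != u)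
    ln (bluew p h (corr R V D x u v))) / 2)) <=
  expR (m ^+ 2 / 2 * ((1 - m^-1) * ln (1 - p) +
    p ^+ 2 * h ^+ 2 / (1 - z) * (1 / 2 + th / 3 + th ^+ 2 / 2)
    - p * (1 - p) * h ^+ 2 / 2 * (1 - 7 * z))).
Proof.
move=> rp th th2; have [prm /andP[D0 b0] vz _ _] := rp; have [p01 h0 /andP[z0 z4] _] := prm.
have /andP[p0 p1] := p01.
have z1 : 0 < 1 - z by lra.
have Vm : (0 < #|{: V}|)%N by rewrite card_groups muln_gt0.
have mp : 0 < m by rewrite ltr0n.
have Dp : 0 < D%:R :> R by rewrite ltr0n.
have a0 : 0 <= p * h / (1 - z) by rewrite divr_ge0 ?mulr_ge0//; lra.
have := clique_avg p h z (ln (1 - p)) (p * h) _ rp.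
move=> /(_ _ (bitavg_expR_corr_pos R V D _ D0 a0 th2)).
under eq_bitavg => x.
  under eq_bigr => u _ do under eq_bigr => v _ do rewrite -ln_bluew//.
  over.
move/le_trans; apply; rewrite ler_expR -/th.
rewrite le_eqVlt; apply/orP; left; apply/eqP.
have -> : D%:R ^+ 2 * (th ^+ 2 / 4 + th ^+ 3 / 6 + th ^+ 4 / 4) =
   (D%:R * th) ^+ 2 * (1 / 4 + th / 6 + th ^+ 2 / 4) by field.
have -> : D%:R * th = p * h / (1 - z) * m by rewrite /th; field; rewrite !gt_eqF.
by field; rewrite !gt_eqF.
Qed.

End CliqueBounds.

(** * Ramsey's theorem, monotonicity and the first moment method *)

Section RamseyNumbers.

Lemma mono_clique_setU1 n (c : colouring n) t (x : 'I_n) (S : {set 'I_n}) :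
  (forall y, y \in S -> (x < y)%N /\ c x y = t) -> mono_clique c t S ->
  mono_clique c t (x |: S).
Proof.
move=> xS cS i j; rewrite !inE => /predU1P[->|iS] /predU1P[->|jS]; first by rewrite ltnn.
- by move=> _; case: (xS _ jS).
- by case: (xS _ iS) => xi _ ix; have := ltn_trans xi ix; rewrite ltnn.
- exact: cS.
Qed.

(** The Erdos-Szekeres recursion, inside an arbitrary vertex set [A] so that it can be applied to
    neighbourhoods of a vertex. *)
Lemma ramsey_in_sets l k : exists n, forall N (c : colouring N) (A : {set 'I_N}), (n <= #|A|)%N ->
  exists2 S : {set 'I_N}, S \subset A &
    (#|S| = l /\ mono_clique c true S) \/ (#|S| = k /\ mono_clique c false S).
Proof.
have mono0 N (c : colouring N) t : mono_clique c t finset.set0 by move=> i j; rewrite inE.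
elim: l k => [|l IHl] k.
  by exists 0%N => N c A _; exists finset.set0; rewrite ?finset.sub0set//; left; rewrite cards0.
elim: k => [|k [n2 IH2]].
  by exists 0%N => N c A _; exists finset.set0; rewrite ?finset.sub0set//; right; rewrite cards0.
have [n1 IH1] := IHl k.+1.
exists (n1 + n2).+1 => N c A An.
have [x0 x0A] : exists x, x \in A by apply/card_gt0P; exact: leq_ltn_trans An.
(* The least vertex is taken because [mono_clique] reads [c i j] only for [i < j]. *)
pose x := [arg min_(i < x0 in A) (i : nat)].
have [xA xmin] : x \in A /\ forall y, y \in A -> (x <= y)%N.
  by rewrite /x; case: arg_minnP => // i iA imin.
have xlt y : y \in A :\ x -> (x < y)%N.
  by rewrite !inE => /andP[yx /xmin]; rewrite leq_eqVlt eq_sym (inj_eq val_inj) (negbTE yx).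
pose A1 := [set y in A :\ x | c x y]; pose A2 := [set y in A :\ x | ~~ c x y].
have A12 : (#|A1| + #|A2| = #|A|.-1)%N.
  rewrite (cardsD1 x A) xA add1n /= -(cardsID [set y | c x y] (A :\ x)); congr (_ + _)%N.
    by apply: eq_card => y; rewrite !inE.
  by apply: eq_card => y; rewrite !inE andbC.
have subA (B : {set 'I_N}) t : B \subset [set y in A :\ x | c x y == t] ->
    [/\ x |: B \subset A, #|x |: B| = #|B|.+1 & forall y, y \in B -> (x < y)%N /\ c x y = t].
  move=> /fintype.subsetP sB; split.
  - apply/fintype.subsetP => y; rewrite inE => /orP[|/sB]; rewrite !inE.
      by move/eqP->.
    by case/andP => /andP[].
  - rewrite cardsU1 (_ : x \notin B)//; apply/negP => /sB.
    by rewrite !inE eqxx.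
  - by move=> y /sB; rewrite inE => /andP[/xlt ? /eqP].
have [A1n|A1n] := leqP n1 #|A1|.
  have [S SA [[Sl cS]|blue]] := IH1 _ c _ A1n.
    have [|sA cA sx] := subA S true.
      by apply: fintype.subset_trans SA _; apply/fintype.subsetP => y; rewrite !inE => /andP[-> ->].
    exists (x |: S) => //; left; rewrite cA Sl; split => //.
    exact: mono_clique_setU1.
  exists S; last by right.
  by apply: fintype.subset_trans SA _; apply/fintype.subsetP => y; rewrite !inE => /andP[/andP[]].
have A2n : (n2 <= #|A2|)%N by lia.
have [S SA [red|[Sk cS]]] := IH2 _ c _ A2n.
  exists S; last by left.
  by apply: fintype.subset_trans SA _; apply/fintype.subsetP => y; rewrite !inE => /andP[/andP[]].
have [|sA cA sx] := subA S false.
  by apply: fintype.subset_trans SA _; apply/fintype.subsetP => y; rewrite !inE => /andP[-> /negbTE->].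
exists (x |: S) => //; right; rewrite cA Sk; split => //.
exact: mono_clique_setU1.
Qed.

(** A lower bound on [ramsey] has to exclude its fallback value [0]. *)
Lemma ramsey_prop_exists l k : exists n, ramsey_prop l k n.
Proof.
have [n Hn] := ramsey_in_sets l k; exists n => c.
have [|S _ HS] := Hn n c [set: 'I_n]; first by rewrite cardsT card_ord.
by exists S.
Qed.

Lemma ramsey_prop_leq l k n n' : (n <= n')%N -> ramsey_prop l k n -> ramsey_prop l k n'.
Proof.
move=> nn' H c.
have [S HS] := H (fun i j => c (widen_ord nn' i) (widen_ord nn' j)).
have wi : injective (widen_ord nn') by move=> i j /(congr1 val) /= ?; apply: val_inj.
exists [set widen_ord nn' i | i in S]; rewrite card_imset//.
suff M t : mono_clique (fun i j => c (widen_ord nn' i) (widen_ord nn' j)) t S ->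
    mono_clique c t [set widen_ord nn' i | i in S].
  by case: HS => -[-> /M ?]; [left|right].
by move=> cS _ _ /imsetP[i iS ->] /imsetP[j jS ->]; exact: cS.
Qed.

Lemma exists_subset_card (T : finType) (S : {set T}) m : (m <= #|S|)%N ->
  exists2 S' : {set T}, S' \subset S & #|S'| = m.
Proof.
move=> mS; exists [set x in take m (enum S)].
  by apply/fintype.subsetP => x; rewrite inE => /mem_take; rewrite mem_enum.
rewrite cardsE (card_uniqP _) ?take_uniq ?enum_uniq// size_take -cardE.
by case: ltngtP mS.
Qed.

Lemma ramsey_prop_sub l k l' k' n : (l' <= l)%N -> (k' <= k)%N ->
  ramsey_prop l k n -> ramsey_prop l' k' n.
Proof.
move=> ll kk H c; have [S HS] := H c.
case: HS => -[Sc cS].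
  have [S' sS Sc'] : exists2 S' : {set 'I_n}, S' \subset S & #|S'| = l'.
    by apply: exists_subset_card; rewrite Sc.
  by exists S'; left; split => // i j /(fintype.subsetP sS) iS /(fintype.subsetP sS); exact: cS.
have [S' sS Sc'] : exists2 S' : {set 'I_n}, S' \subset S & #|S'| = k'.
  by apply: exists_subset_card; rewrite Sc.
by exists S'; right; split => // i j /(fintype.subsetP sS) iS /(fintype.subsetP sS); exact: cS.
Qed.

Lemma not_ramsey_prop_ltn l k n : ~ ramsey_prop l k n -> (n < ramsey l k)%N.
Proof.
move=> H; rewrite /ramsey; case: pselect => [e|]; last first.
  by case; have [m Hm] := ramsey_prop_exists l k; exists m; apply/asboolP.
case: ex_minnP => m /asboolP Hm _; rewrite ltnNge; apply/negP => mn.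
exact: H (ramsey_prop_leq _ _ _ _ mn Hm).
Qed.

Section FirstMoment.
Variables (R : realType) (n : nat).

(** Colour the edges independently with the given probabilities. The left side is the expected
    number of forbidden cliques, and under [ramsey_prop] every colouring contains at least one. *)
Lemma first_moment (wr wb : 'I_n -> 'I_n -> R) l k :
  (forall i j, 0 <= wr i j) -> (forall i j, 0 <= wb i j) ->
  (forall i j, wr i j + wb i j = 1) ->
  \sum_(S : {set 'I_n} | #|S| == l) \prod_(i in S) \prod_(j in S | (i < j)%N) wr i j +
  \sum_(S : {set 'I_n} | #|S| == k) \prod_(i in S) \prod_(j in S | (i < j)%N) wb i j < 1 ->
  ~ ramsey_prop l k n.
Proof.
move=> r0 b0 rb lt1 Hr; move: lt1; apply/negP; rewrite -leNgt.
(* All ordered pairs are coloured; those with [i >= j] contribute a factor one after summation over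
   their colours. *)
pose E := ('I_n * 'I_n)%type.
pose v (e : E) (t : bool) : R := if t then wr e.1 e.2 else wb e.1 e.2.
have v0 e t : 0 <= v e t by rewrite /v; case: t.
have v1 e : \sum_t v e t = 1 by rewrite big_bool /v /= rb.
pose W (c : {ffun E -> bool}) := \prod_e v e (c e).
have W0 c : 0 <= W c by apply: prodr_ge0 => e _; exact: v0.
have W1 : \sum_c W c = 1.
  by rewrite -(bigA_distr_bigA v) /=; rewrite big1// => e _.
pose inS (S : {set 'I_n}) (e : E) := [&& e.1 \in S, e.2 \in S & (e.1 < e.2)%N].
pose mono (t : bool) (S : {set 'I_n}) (c : {ffun E -> bool}) :=
  [forall e, inS S e ==> (c e == t)].
have monoW t S : \sum_c W c * (mono t S c)%:R =
    \prod_(i in S) \prod_(j in S | (i < j)%N) v (i, j) t.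
  transitivity (\sum_(c : {ffun E -> bool}) \prod_e (v e (c e) * (inS S e ==> (c e == t))%:R)).
    apply: eq_bigr => c _; rewrite big_split /=; congr (_ * _).
    have [/forallP H|/forallPn[e He]] := boolP (mono t S c).
      by rewrite big1// => e _; rewrite H.
    by rewrite (bigD1 e)//= (negbTE He) mul0r.
  rewrite -(bigA_distr_bigA (fun e s => v e s * (inS S e ==> (s == t))%:R)) /=.
  transitivity (\prod_e (if inS S e then v e t else 1)).
    apply: eq_bigr => e _; case: ifP => _ /=; last by under eq_bigr do rewrite mulr1.
    by rewrite big_bool; case: t => /=; rewrite ?mulr1 ?mulr0 ?addr0 ?add0r.
  rewrite -big_mkcond /= [RHS](pair_big_dep _ (fun (i j : 'I_n) => (j \in S) && (i < j)%N)) /=.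
  by apply: eq_big => [[i j]|[i j]].
have -> : \sum_(S : {set 'I_n} | #|S| == l) \prod_(i in S) \prod_(j in S | (i < j)%N) wr i j =
    \sum_(S : {set 'I_n} | #|S| == l) \sum_c W c * (mono true S c)%:R.
  by apply: eq_bigr => S _; rewrite monoW.
have -> : \sum_(S : {set 'I_n} | #|S| == k) \prod_(i in S) \prod_(j in S | (i < j)%N) wb i j =
    \sum_(S : {set 'I_n} | #|S| == k) \sum_c W c * (mono false S c)%:R.
  by apply: eq_bigr => S _; rewrite monoW.
rewrite exchange_big [X in _ + X]exchange_big -big_split /= -[leLHS]W1.
apply: ler_sum => c _; rewrite -!mulr_sumr -mulrDr -[leLHS]mulr1 ler_wpM2l//.
have sum0 (P : pred {set 'I_n}) t : 0 <= \sum_(S | P S) (mono t S c)%:R :> R.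
  by apply: sumr_ge0.
have monoP t S : mono_clique (fun i j => c (i, j)) t S -> mono t S c.
  by move=> H; apply/forallP => -[i j]; apply/implyP => /and3P[iS jS ij]; rewrite H.
have [S [[Sl /monoP H]|[Sk /monoP H]]] := Hr (fun i j => c (i, j)).
  rewrite (bigD1 S) /= ?Sl// H mulr1n -addrA lerDl.
  by rewrite addr_ge0//; apply: sumr_ge0.
rewrite [X in _ + X](bigD1 S) /= ?Sk// H mulr1n addrCA lerDl.
by rewrite addr_ge0//; apply: sumr_ge0.
Qed.

End FirstMoment.
End RamseyNumbers.

(** * Union bound over cliques for the correlated random colouring *)

Section UnionBound.
Variable R : realType.

Lemma bin_leq_exp n m : ('C(n, m) <= n ^ m)%N.
Proof.
have ff : (n ^_ m <= n ^ m)%N.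
  elim: m => [|m IH]; first by rewrite ffactn0.
  by rewrite ffactnSr expnSr leq_mul// leq_subr.
by apply: leq_trans ff; rewrite -bin_ffact leq_pmulr// fact_gt0.
Qed.

(** The weight of a clique depends only on the sign vectors of its vertices, so its mean can be
    computed on any labelling [V] of them, in particular on one arranged in groups. *)
Lemma clique_weight_avg (n D : nat) (V : finType) (S : {set 'I_n}) (f : R -> R) (B : R) :
  #|S| = #|V| -> (forall s, 0 < f s) ->
  bitavg R (V * 'I_(D ^ 2))%type (fun x =>
    expR ((\sum_u \sum_(v | v != u) ln (f (corr R V D x u v))) / 2)) <= B ->
  bitavg R ('I_n * 'I_(D ^ 2))%type (fun x =>
    \prod_(i in S) \prod_(j in S | (i < j)%N) f (corr R 'I_n D x i j)) <= B.
Proof.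
move=> SV f0 HB.
pose g (u : V) : 'I_n := enum_val (cast_ord (esym SV) (enum_rank u)).
have gi : injective g by move=> u v /enum_val_inj /cast_ord_inj /enum_rank_inj.
have gS : [set g u | u in V] = S.
  apply/eqP; rewrite eqEcard card_imset// SV leqnn andbT.
  by apply/fintype.subsetP => _ /imsetP[u _ ->]; exact: enum_valP.
rewrite -(bitavg_restr _ _ _ (lift_vertex 'I_n V D g)) in HB; last exact: lift_vertex_inj.
apply: le_trans HB; apply: bitavg_le => x.
rewrite le_eqVlt; apply/orP; left; apply/eqP.
pose T (i j : 'I_n) := if (i \in S) && (j \in S) then ln (f (corr R 'I_n D x i j)) else 0.
have Ts i j : T i j = T j i by rewrite /T andbC corrC.
have -> : \sum_u \sum_(v | v != u) ln (f (corr R V D (restr _ _ (lift_vertex 'I_n V D g) x) u v)) =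
    \sum_(i < n) \sum_(j < n | j != i) T i j.
  transitivity (\sum_(i in S) \sum_(j in S | j != i) T i j).
    rewrite -gS big_imset /=; last by move=> u v _ _; exact: gi.
    apply: eq_bigr => u _; rewrite big_mkcondr big_imset /=; last by move=> v v' _ _; exact: gi.
    rewrite -big_mkcond; apply: eq_big => [v|v _]; first by rewrite (inj_eq gi).
    by rewrite corr_lift /T -gS !imset_f.
  rewrite big_mkcond; apply: eq_bigr => i _; case: ifP => iS; last first.
    by rewrite big1// => j _; rewrite /T iS.
  rewrite big_mkcondl; apply: eq_bigr => j _; case: ifP => // jS.
  by rewrite /T jS andbF.
rewrite sum_neq_sym// [2 * _]mulrC mulfK// expR_sum big_mkcond.
apply: eq_bigr => i _; rewrite expR_sum; case: ifP => iS; last first.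
  by rewrite big1// => j _; rewrite /T iS expR0.
rewrite big_mkcondl; apply: eq_bigr => j _; rewrite /T iS /=; case: ifP => _.
  by rewrite lnK// posrE.
by rewrite expR0.
Qed.

(** If [ramsey_prop] held, then for every choice of sign vectors [first_moment] would force the
    total clique weight to be at least one, and so would be its average. *)
Lemma not_ramsey_avg (n D : nat) (V1 V2 : finType) (p h B1 B2 : R) : 0 < p < 1 ->
  bitavg R (V1 * 'I_(D ^ 2))%type (fun x =>
    expR ((\sum_u \sum_(v | v != u) ln (redw R p h (corr R V1 D x u v))) / 2)) <= B1 ->
  bitavg R (V2 * 'I_(D ^ 2))%type (fun x =>
    expR ((\sum_u \sum_(v | v != u) ln (bluew R p h (corr R V2 D x u v))) / 2)) <= B2 ->
  n%:R ^+ #|V1| * B1 + n%:R ^+ #|V2| * B2 < 1 ->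
  ~ ramsey_prop #|V1| #|V2| n.
Proof.
move=> p01 H1 H2 lt1 Hr.
have B0 (V : finType) f B : bitavg R (V * 'I_(D ^ 2))%type (fun x => expR (f x)) <= B -> 0 <= B.
  by apply: le_trans; apply: bitavg_ge0 => x; exact: expR_ge0.
have sumB (V : finType) (f : R -> R) B : (forall s, 0 < f s) -> 0 <= B ->
  bitavg R (V * 'I_(D ^ 2))%type (fun x =>
    expR ((\sum_u \sum_(v | v != u) ln (f (corr R V D x u v))) / 2)) <= B ->
  bitavg R ('I_n * 'I_(D ^ 2))%type (fun x => \sum_(S : {set 'I_n} | #|S| == #|V|)
    \prod_(i in S) \prod_(j in S | (i < j)%N) f (corr R 'I_n D x i j)) <= n%:R ^+ #|V| * B.
  move=> f0 B_ge0 HB; rewrite bitavg_sum.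
  apply: (@le_trans _ _ (\sum_(S : {set 'I_n} | #|S| == #|V|) B)).
    apply: ler_sum => S /eqP SV; exact: clique_weight_avg HB.
  have -> : \sum_(S : {set 'I_n} | #|S| == #|V|) B = 'C(n, #|V|)%:R * B.
    rewrite -[n in 'C(n, _)](card_ord n) -card_draws mulr_natl -sumr_const.
    by apply: eq_bigl => S; rewrite inE.
  by rewrite ler_wpM2r// -natrX ler_nat bin_leq_exp.
have S1 := sumB V1 _ B1 (fun s => redw_gt0 R p h s p01) (B0 _ _ _ H1) H1.
have S2 := sumB V2 _ B2 (fun s => bluew_gt0 R p h s p01) (B0 _ _ _ H2) H2.
have := le_lt_trans (lerD S1 S2) lt1; rewrite -bitavgD; apply/negP; rewrite -leNgt.
rewrite -[leLHS](bitavg_cst R ('I_n * 'I_(D ^ 2))%type); apply: bitavg_le => x.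
rewrite leNgt; apply/negP => /first_moment; apply => //.
- by move=> i j; rewrite ltW// redw_gt0.
- by move=> i j; rewrite ltW// bluew_gt0.
- by move=> i j; exact: redwDbluew.
Qed.

End UnionBound.

(** * Replacing the actual parameters by limiting ones *)

Section Rates.
Variable R : realType.

Lemma square_shift (x y z : R) : 0 < x -> x < 1 -> 0 < y -> y < 1 ->
  x - y <= z -> - z <= x - y -> x ^+ 2 / 2 - (1 - x) * x / 2 <= y ^+ 2 / 2 - (1 - y) * y / 2 + 2 * z.
Proof.
move=> x0 x1 y0 y1 d1 d2.
have : (x - y) * (2 * (x + y) - 1) <= 3 * z by nra.
lra.
Qed.

Lemma cube_shift (x y z T : R) : 0 < x -> x < 1 -> 0 < y -> y < 1 ->
  x - y <= z -> 0 < z -> 0 < T -> T <= 8^-1 -> x ^+ 3 * T <= y ^+ 3 * T + z.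
Proof.
move=> x0 x1 y0 y1 d z0 T0 T1.
have xy0 : 0 < x * y by rewrite mulr_gt0.
have xy1 : x * y <= 1 by rewrite mulr_ile1 ?(ltW x0) ?(ltW y0) ?(ltW x1) ?(ltW y1).
have x21 : x ^+ 2 <= 1 by rewrite expr_le1// ltW.
have y21 : y ^+ 2 <= 1 by rewrite expr_le1// ltW.
have xx := sqr_ge0 x; have yy := sqr_ge0 y.
have e3 : x ^+ 3 - y ^+ 3 <= 3 * z.
  have -> : x ^+ 3 - y ^+ 3 = (x - y) * (x ^+ 2 + x * y + y ^+ 2) by ring.
  have : 0 <= (z - (x - y)) * (x ^+ 2 + x * y + y ^+ 2) by rewrite mulr_ge0; lra.
  have : 0 <= z * (3 - (x ^+ 2 + x * y + y ^+ 2)) by rewrite mulr_ge0; lra.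
  lra.
have : 0 <= (3 * z - (x ^+ 3 - y ^+ 3)) * T by rewrite mulr_ge0; lra.
have : 0 <= z * (8^-1 - T) by rewrite mulr_ge0; lra.
lra.
Qed.

(** Errors linear in [z] are collected in [20 * z], those quadratic in [th] in [Th ^+ 2]. The lower
    bound on [th] secures the gain from the triangle term [- th / 3]. *)
Lemma red_rate_le (p0 p Th z th im : R) : 0 < p0 < 1 -> 0 < p < 1 -> `|p - p0| <= z ->
  0 < Th <= 8^-1 -> 0 < z <= 8^-1 -> (1 - p) * Th * (1 - z) <= th <= 2 * Th ->
  0 <= im -> 2 * im <= z ->
  (1 - p) ^+ 2 / (1 - z) * (1 / 2 - th / 3 + th ^+ 2 / 4 + 2 * im)
    - p * (1 - p) / 2 * (1 - 7 * z) <=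
  (1 - p0) ^+ 2 / 2 - p0 * (1 - p0) / 2 - (1 - p0) ^+ 3 * Th / 3 + Th ^+ 2 + 20 * z.
Proof.
move=> /andP[p00 p01] /andP[p_0 p_1]; rewrite ler_norml => /andP[d1 d2] /andP[T0 T1].
move=> /andP[z0 z1] /andP[th1 th2] im0 imz.
set q := 1 - p in th1 *; set q0 := 1 - p0.
have qb : 0 < q < 1 by rewrite /q; lra.
have q0b : 0 < q0 < 1 by rewrite /q0; lra.
have dq : - z <= q - q0 <= z by rewrite /q /q0; lra.
have -> : p = 1 - q by rewrite /q; ring.
have -> : p0 = 1 - q0 by rewrite /q0; ring.
move: (q) (q0) qb q0b dq th1 => {q q0 d1 d2 p00 p01 p_0 p_1 p p0} q q0.
move=> /andP[qp q1] /andP[q0p q01] /andP[dq1 dq2] th1.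
have dq3 : q0 - q <= z by lra.
have qT0 : 0 < q * Th by rewrite mulr_gt0.
have qT1 : q * Th <= Th by rewrite -[leRHS]mul1r ler_pM2r// ltW.
have zT : 0 <= z * (q * Th) by rewrite mulr_ge0// ltW.
have zT8 : z * (q * Th) <= z / 8 by rewrite ler_wpM2l ?(ltW z0)//; lra.
have th0 : 0 <= th by nra.
have thT : th ^+ 2 <= 4 * Th ^+ 2.
  have -> : 4 * Th ^+ 2 = (2 * Th) ^+ 2 by ring.
  by rewrite lerXn2r// nnegrE; lra.
have T2 : Th ^+ 2 <= 64^-1.
  have -> : 64^-1 = 8^-1 ^+ 2 :> R by rewrite exprVn -natrX.
  by rewrite lerXn2r// nnegrE; lra.
have TT := sqr_ge0 Th.
set A := 1 / 2 - th / 3 + th ^+ 2 / 4 + 2 * im.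
set A' := 1 / 2 - q * Th * (1 - z) / 3 + Th ^+ 2 + z.
have AA : A <= A' by rewrite /A /A'; lra.
have A'0 : 0 <= A' by rewrite /A'; nra.
have A'1 : A' <= 1 by rewrite /A'; nra.
have q2 : 0 <= q ^+ 2 by exact: sqr_ge0.
have q21 : q ^+ 2 <= 1 by rewrite expr_le1// ltW.
have s1 : q ^+ 2 / (1 - z) <= q ^+ 2 + 2 * z.
  rewrite ler_pdivrMr; last by lra.
  nra.
have s2 : q ^+ 2 / (1 - z) * A <= q ^+ 2 * A' + 2 * z.
  apply: le_trans (ler_wpM2l _ AA) _; first by rewrite divr_ge0//; lra.
  apply: le_trans (ler_wpM2r A'0 s1) _.
  by rewrite mulrDl lerD2l -[leRHS]mulr1 ler_wpM2l//; lra.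
have s3 : q ^+ 2 * A' <= q ^+ 2 / 2 - q ^+ 3 * Th / 3 + Th ^+ 2 + 2 * z.
  have -> : q ^+ 2 * A' = q ^+ 2 / 2 - q ^+ 3 * Th / 3 + q ^+ 2 * (z * (q * Th) / 3 + Th ^+ 2 + z).
    by rewrite /A'; field.
  have : q ^+ 2 * (z * (q * Th) / 3 + Th ^+ 2 + z) <= 1 * (z * (q * Th) / 3 + Th ^+ 2 + z).
    by rewrite ler_wpM2r//; lra.
  lra.
have qq4 : q * (1 - q) <= 4^-1 by have := sqr_ge0 (q - 2^-1); lra.
have qq0 : 0 <= q * (1 - q) by rewrite mulr_ge0; lra.
have s4 : q * (1 - q) * z <= 4^-1 * z by rewrite ler_wpM2r// ltW.
have s5 := square_shift q q0 z qp q1 q0p q01 dq2 dq1.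
have s6 := cube_shift q0 q z Th q0p q01 qp q1 dq3 z0 T0 T1.
lra.
Qed.

(** For blue the triangle term is a loss, so [th] is bounded from above; [C] enters only through the
    product [C * Th]. *)
Lemma blue_rate_le (C p0 p Th z th : R) : 1 < C -> 0 < p0 < 1 -> 0 < p < 1 -> `|p - p0| <= z ->
  0 < Th -> C * Th <= 8^-1 -> 0 < z <= 8^-1 -> 0 <= th <= p * Th * C / (1 - z) ->
  p ^+ 2 / (1 - z) * (1 / 2 + th / 3 + th ^+ 2 / 2) - p * (1 - p) / 2 * (1 - 7 * z) <=
  p0 ^+ 2 / 2 - p0 * (1 - p0) / 2 + p0 ^+ 3 * C * Th / 3 + 2 * C ^+ 2 * Th ^+ 2 + 20 * z.
Proof.
move=> C1 /andP[p00 p01] /andP[p_0 p_1]; rewrite ler_norml => /andP[d1 d2] T0 CT.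
move=> /andP[z0 z1] /andP[th0 th1].
have -> : p0 ^+ 3 * C * Th = p0 ^+ 3 * (C * Th) by ring.
have -> : 2 * C ^+ 2 * Th ^+ 2 = 2 * (C * Th) ^+ 2 by ring.
have CT0 : 0 < C * Th by rewrite mulr_gt0//; lra.
have {}th1 : th <= p * (C * Th) / (1 - z) by rewrite (_ : p * (C * Th) = p * Th * C)//; ring.
move: (C * Th) CT0 CT th1 => T {C1 T0 Th C} T0 T1 th1.
have pT0 : 0 < p * T by rewrite mulr_gt0.
have pT1 : p * T <= T by rewrite -[leRHS]mul1r ler_pM2r// ltW.
have zT8 : z * (p * T) <= z / 8 by rewrite ler_wpM2l ?(ltW z0)//; lra.
have zT0 : 0 <= z * (p * T) by rewrite mulr_ge0// ltW.
have th2 : th <= p * T + 2 * (z * (p * T)).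
  apply: le_trans th1 _; rewrite ler_pdivrMr; last by lra.
  by nra.
have th3 : th <= 2 * T by nra.
have thT : th ^+ 2 <= 4 * T ^+ 2.
  have -> : 4 * T ^+ 2 = (2 * T) ^+ 2 by ring.
  by rewrite lerXn2r// nnegrE; lra.
have T2 : T ^+ 2 <= 64^-1.
  have -> : 64^-1 = 8^-1 ^+ 2 :> R by rewrite exprVn -natrX.
  by rewrite lerXn2r// nnegrE; lra.
have TT := sqr_ge0 T; have hh := sqr_ge0 th.
set A := 1 / 2 + th / 3 + th ^+ 2 / 2.
set A' := 1 / 2 + p * T / 3 + 2 * T ^+ 2 + z.
have AA : A <= A' by rewrite /A /A'; lra.
have A'0 : 0 <= A' by rewrite /A'; lra.
have A'1 : A' <= 1 by rewrite /A'; lra.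
have q2 : 0 <= p ^+ 2 by exact: sqr_ge0.
have q21 : p ^+ 2 <= 1 by rewrite expr_le1// ltW.
have s1 : p ^+ 2 / (1 - z) <= p ^+ 2 + 2 * z.
  rewrite ler_pdivrMr; last by lra.
  nra.
have s2 : p ^+ 2 / (1 - z) * A <= p ^+ 2 * A' + 2 * z.
  apply: le_trans (ler_wpM2l _ AA) _; first by rewrite divr_ge0//; lra.
  apply: le_trans (ler_wpM2r A'0 s1) _.
  by rewrite mulrDl lerD2l -[leRHS]mulr1 ler_wpM2l//; lra.
have s3 : p ^+ 2 * A' <= p ^+ 2 / 2 + p ^+ 3 * T / 3 + 2 * T ^+ 2 + z.
  have -> : p ^+ 2 * A' = p ^+ 2 / 2 + p ^+ 3 * T / 3 + p ^+ 2 * (2 * T ^+ 2 + z).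
    by rewrite /A'; field.
  have : p ^+ 2 * (2 * T ^+ 2 + z) <= 1 * (2 * T ^+ 2 + z).
    by rewrite ler_wpM2r//; lra.
  lra.
have qq4 : p * (1 - p) <= 4^-1 by have := sqr_ge0 (p - 2^-1); lra.
have qq0 : 0 <= p * (1 - p) by rewrite mulr_ge0; lra.
have s4 : p * (1 - p) * z <= 4^-1 * z by rewrite ler_wpM2r// ltW.
have s5 := square_shift p p0 z p_0 p_1 p00 p01 d2 d1.
have s6 := cube_shift p p0 z T p_0 p_1 p00 p01 d2 z0 T0 T1.
lra.
Qed.

End Rates.

(** * The critical density *)

Section CriticalDensity.
Variable R : realType.

(* The triangle counts of the two colours balance exactly at [p = 1/2]; away
   from it the gain for red cliques beats the loss for blue ones. *)
Lemma gain_beats_loss (C p : R) : 0 < p < 2^-1 -> C = ln p / ln (1 - p) ->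
  C * p ^+ 2 < (1 - p) ^+ 2.
Proof.
move=> /andP[p0 p1] CE.
have q0 : 0 < 1 - p by lra.
have lq : ln (1 - p) < - p.
  have e := @expR_gt1Dx R (- p); rewrite oppr_eq0 gt_eqF// in e.
  have {}e := e isT; rewrite -[ltRHS]expRK ltr_ln ?posrE ?expR_gt0//.
have lp : - ln p <= - ln (1 - p) + (1 - 2 * p) / p.
  have : ln (1 + ((1 - p) / p - 1)) <= (1 - p) / p - 1.
    have r0 : 0 < (1 - p) / p by rewrite divr_gt0.
    by apply: le_ln1Dx; lra.
  rewrite subrKC ln_div ?posrE//.
  have -> : (1 - p) / p - 1 = (1 - 2 * p) / p by field; rewrite gt_eqF.
  lra.
have lq0 : ln (1 - p) < 0 by lra.
rewrite CE mulrAC ltr_ndivrMr//.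
have : - ln p * p ^+ 2 <= (- ln (1 - p) + (1 - 2 * p) / p) * p ^+ 2.
  by rewrite ler_wpM2r// sqr_ge0.
have -> : (- ln (1 - p) + (1 - 2 * p) / p) * p ^+ 2 = - ln (1 - p) * p ^+ 2 + p * (1 - 2 * p).
  by field; rewrite gt_eqF.
have : p * (1 - 2 * p) < - ln (1 - p) * (1 - 2 * p) by rewrite ltr_pM2r; lra.
lra.
Qed.

Lemma exists_unique_root (C : R) : 1 < C ->
  exists! p : R, 0 < p < 2^-1 /\ C = ln p / ln (1 - p).
Proof.
move=> C1; pose G (p : R) := C * ln (1 - p) - ln p.
have GE p : 0 < p < 2^-1 -> C = ln p / ln (1 - p) <-> G p = 0.
  move=> /andP[p0 p1]; have lq0 : ln (1 - p) != 0 by rewrite lt_eqF// ln_lt0; lra.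
  rewrite /G; split => [->|/eqP]; first by rewrite divfK ?subrr.
  by rewrite subr_eq0 => /eqP <-; rewrite mulfK.
have Gdec p p' : 0 < p -> p < p' -> p' <= 2^-1 -> G p' < G p.
  move=> p0 pp p1.
  have l1 : ln p < ln p' by rewrite ltr_ln ?posrE; lra.
  have l2 : ln (1 - p') < ln (1 - p) by rewrite ltr_ln ?posrE; lra.
  by rewrite /G; nra.
have ln2 : ln (2^-1 : R) < 0 by rewrite ln_lt0; lra.
(* A left end point for the intermediate value theorem: [G a = C * (ln (1 - a) - ln 2^-1) + 1 > 0]
   as [a < 2^-1]. *)
pose a : R := expR (C * ln 2^-1 - 1).
have a0 : 0 < a by exact: expR_gt0.
have a2 : a < 2^-1.
  by rewrite -[ltRHS]lnK ?posrE ?invr_gt0// ltr_expR; nra.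
have Ga : 0 < G a.
  have : ln 2^-1 < ln (1 - a) by rewrite ltr_ln ?posrE ?invr_gt0//; lra.
  by rewrite /G expRK; nra.
have Gb : G 2^-1 < 0.
  by rewrite /G (_ : 1 - 2^-1 = 2^-1); [nra|field].
have [||c] := @IVT R G a 2^-1 0 (ltW a2).
- apply: derivable_within_continuous => x; rewrite in_itv/= => /andP[ax x2].
  have x0 : 0 < x by lra.
  have q0 : 0 < 1 - x by lra.
  have d1 := is_derive1_ln x0; have d2 := is_derive1_ln q0.
  exact: ex_derive.
- by rewrite ge_min le_max (ltW Ga) (ltW Gb) orbT.
rewrite in_itv/= => /andP[ac c2] Gc.
have {}c2 : c < 2^-1.
  by rewrite lt_neqAle c2 andbT; apply/eqP => ce; move: Gb; rewrite -ce Gc ltxx.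
have c0 : 0 < c by lra.
exists c; split; first by split; [rewrite c0|apply/GE; rewrite ?c0].
move=> p [p01 /(GE _ p01) Gp]; have /andP[p0 p1] := p01.
case: (ltrgtP c p) => // cp.
  by have := Gdec _ _ c0 cp (ltW p1); rewrite Gp Gc ltxx.
by have := Gdec _ _ p0 cp (ltW c2); rewrite Gp Gc ltxx.
Qed.

End CriticalDensity.

(** * Clique bounds with a fixed margin, and the number of groups *)

Section ExponentialGain.
Variable R : realType.

Lemma ln_le_tangent (x y : R) : 0 < x -> 0 < y -> ln y <= ln x + (y - x) / x.
Proof.
move=> x0 y0; have r0 : 0 < y / x by rewrite divr_gt0.
have := @le_ln1Dx R (y / x - 1); rewrite subrKC ln_div ?posrE// => H.
have -> : (y - x) / x = y / x - 1 by field; rewrite gt_eqF.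
by rewrite -lerBlDl; apply: H; lra.
Qed.

(** The tangent of [ln] at [p0] turns the shift of the density into the term [y / p0]. Half of the
    margin [2 * eta] pays for [- ln p / m], the difference between [m ^+ 2 / 2] and the true number
    of edges. *)
Lemma red_clique_bound (w0 b D : nat) (p0 p h z Th eta y : R) :
  let m : R := #|{: 'I_w0.+1 * 'I_b}|%:R in
  let th := (1 - p) * h / (1 - z) * m / D%:R in
  round_params R w0 b D p h z -> z <= 8^-1 -> 0 < p0 < 1 -> p = p0 + y * h ^+ 2 ->
  `|p - p0| <= z -> 0 < Th <= 8^-1 -> (1 - p) * Th * (1 - z) <= th <= 2 * Th ->
  (1 - p) * h / (1 - z) / (2 * D%:R) <= 4^-1 -> 2 / m <= z -> - ln p / m <= eta ->
  h ^+ 2 * (y / p0 + ((1 - p0) ^+ 2 / 2 - p0 * (1 - p0) / 2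
    - (1 - p0) ^+ 3 * Th / 3 + Th ^+ 2 + 20 * z)) <= - (2 * eta) ->
  bitavg R ('I_w0.+1 * 'I_b * 'I_(D ^ 2))%type (fun x => expR ((\sum_u \sum_(v | v != u)
    ln (redw R p h (corr R _ D x u v))) / 2)) <= expR (m ^+ 2 / 2 * (ln p0 - eta)).
Proof.
move=> m th rp z8 p001 pE dp Th01 thb D4 mz leta marg.
have [prm /andP[D0 b0] _ _ _] := rp; have [p01 h0 /andP[z0 _] _] := prm.
have mp : 0 < m by rewrite ltr0n card_groups muln_gt0.
apply: le_trans (red_clique_avg R w0 b D p h z rp D4) _.
rewrite ler_expR -/m -/th ler_wpM2l//; first by rewrite divr_ge0// sqr_ge0.
have z01 : 0 < z <= 8^-1 by rewrite z0.
have im0 : 0 <= m^-1 by rewrite invr_ge0 ltW.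
have rr := red_rate_le R p0 p Th z th m^-1 p001 p01 dp Th01 z01 thb im0 mz.
have h2 : 0 <= h ^+ 2 by exact: sqr_ge0.
have := ler_wpM2l h2 rr.
have /andP[p00 _] := p001; have /andP[p_0 _] := p01.
have := ln_le_tangent p0 p p00 p_0.
have -> : (p - p0) / p0 = h ^+ 2 * (y / p0) by rewrite pE; field; rewrite gt_eqF.
have -> : (1 - m^-1) * ln p = ln p + - ln p / m by ring.
have -> : (1 - p) ^+ 2 * h ^+ 2 / (1 - z) * (1 / 2 - th / 3 + th ^+ 2 / 4 + 2 / m) =
  h ^+ 2 * ((1 - p) ^+ 2 / (1 - z) * (1 / 2 - th / 3 + th ^+ 2 / 4 + 2 / m)) by ring.
have -> : p * (1 - p) * h ^+ 2 / 2 * (1 - 7 * z) =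
  h ^+ 2 * (p * (1 - p) / 2 * (1 - 7 * z)) by ring.
move: (_ / (1 - z) * _) (p * (1 - p) / 2 * _) marg => K1 K2.
by move: (_ - _ + _ + _) (y / p0) (- ln p / m) leta => K3 K4 K5; lra.
Qed.

Lemma blue_clique_bound (w0 b D : nat) (C p0 p h z Th eta y : R) :
  let m : R := #|{: 'I_w0.+1 * 'I_b}|%:R in
  let th := p * h / (1 - z) * m / D%:R in
  round_params R w0 b D p h z -> z <= 8^-1 -> 1 < C -> 0 < p0 < 1 -> p = p0 + y * h ^+ 2 ->
  `|p - p0| <= z -> 0 < Th -> C * Th <= 8^-1 -> th <= p * Th * C / (1 - z) -> th <= 2^-1 ->
  - ln (1 - p) / m <= eta ->
  h ^+ 2 * (- (y / (1 - p0)) + (p0 ^+ 2 / 2 - p0 * (1 - p0) / 2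
    + p0 ^+ 3 * C * Th / 3 + 2 * C ^+ 2 * Th ^+ 2 + 20 * z)) <= - (2 * eta) ->
  bitavg R ('I_w0.+1 * 'I_b * 'I_(D ^ 2))%type (fun x => expR ((\sum_u \sum_(v | v != u)
    ln (bluew R p h (corr R _ D x u v))) / 2)) <= expR (m ^+ 2 / 2 * (ln (1 - p0) - eta)).
Proof.
move=> m th rp z8 C1 p001 pE dp Th0 CT thb th2 leta marg.
have [prm /andP[D0 b0] _ _ _] := rp; have [p01 h0 /andP[z0 _] _] := prm.
have mp : 0 < m by rewrite ltr0n card_groups muln_gt0.
apply: le_trans (blue_clique_avg R w0 b D p h z rp th2) _.
rewrite ler_expR -/m -/th ler_wpM2l//; first by rewrite divr_ge0// sqr_ge0.
have z01 : 0 < z <= 8^-1 by rewrite z0.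
have /andP[p00 p0_1] := p001; have /andP[p_0 p_1] := p01.
have th0 : 0 <= th <= p * Th * C / (1 - z).
  by rewrite thb andbT /th !divr_ge0 ?mulr_ge0 ?divr_ge0 ?mulr_ge0// ?invr_ge0; lra.
have rr := blue_rate_le R C p0 p Th z th C1 p001 p01 dp Th0 CT z01 th0.
have h2 : 0 <= h ^+ 2 by exact: sqr_ge0.
have := ler_wpM2l h2 rr.
have q00 : 0 < 1 - p0 by rewrite subr_gt0.
have q_0 : 0 < 1 - p by rewrite subr_gt0.
have := ln_le_tangent (1 - p0) (1 - p) q00 q_0.
have -> : (1 - p - (1 - p0)) / (1 - p0) = h ^+ 2 * - (y / (1 - p0)).
  by rewrite pE; field; rewrite gt_eqF.
have -> : (1 - m^-1) * ln (1 - p) = ln (1 - p) + - ln (1 - p) / m by ring.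
have -> : p ^+ 2 * h ^+ 2 / (1 - z) * (1 / 2 + th / 3 + th ^+ 2 / 2) =
  h ^+ 2 * (p ^+ 2 / (1 - z) * (1 / 2 + th / 3 + th ^+ 2 / 2)) by ring.
have -> : p * (1 - p) * h ^+ 2 / 2 * (1 - 7 * z) =
  h ^+ 2 * (p * (1 - p) / 2 * (1 - 7 * z)) by ring.
move: (_ / (1 - z) * _) (p * (1 - p) / 2 * _) marg => K1 K2.
by move: (_ + 20 * z) (y / (1 - p0)) (- ln (1 - p) / m) leta => K3 K4 K5; lra.
Qed.

(** [w] is [z ^+ 4 / E] rounded up, or one more if this is an integer. As [E <= h ^+ 2 <= z ^+ 5],
    the rounding changes [w * E] by at most a fraction [z] of [z ^+ 4]. *)
Lemma exists_rounds (p h z : R) : 0 < p < 1 -> 0 < h -> 0 < z <= 4^-1 -> h ^+ 2 <= z ^+ 5 ->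
  exists w0 : nat,
  [/\ 2 * w0.+1%:R * (p * (1 - p) * h ^+ 2 / 2) * (1 - z) ^+ 2 * (1 - 2 * z) <= z ^+ 4 <=
      2 * w0.+1%:R * (p * (1 - p) * h ^+ 2 / 2) * (1 - z) * (1 - 2 * z),
      w0.+1%:R * (1 - z) <= w0%:R & z ^+ 4 <= w0.+1%:R * h ^+ 2].
Proof.
move=> /andP[p0 p1] h0 /andP[z0 z4] hz.
set E := p * (1 - p) * h ^+ 2 * (1 - z) * (1 - 2 * z).
have h2 : 0 < h ^+ 2 by rewrite exprn_gt0.
have pq0 : 0 < p * (1 - p) by rewrite mulr_gt0// subr_gt0.
have pq4 : p * (1 - p) <= 4^-1 by have := sqr_ge0 (p - 2^-1); lra.
have zz0 : 0 < (1 - z) * (1 - 2 * z) by rewrite mulr_gt0; lra.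
have zz1 : (1 - z) * (1 - 2 * z) <= 1 by nra.
have E0 : 0 < E by rewrite /E -mulrA mulr_gt0// mulr_gt0.
have Eh : E <= h ^+ 2.
  rewrite /E -mulrA -[leRHS]mulr1; apply: ler_pM => //; try exact: ltW.
    by apply: mulr_ge0; exact: ltW.
  by rewrite -[leRHS]mul1r ler_pM2r//; lra.
set o := z ^+ 4 / E.
have o0 : 0 <= o by rewrite divr_ge0 ?exprn_ge0 ?(ltW z0) ?(ltW E0).
exists (Num.truncn o); set w0 := Num.truncn o.
have /andP[w0o ow] := truncn_itv o0; rewrite -/w0 in w0o ow.
have wS : w0.+1%:R = w0%:R + 1 :> R by rewrite natr1.
have oE : o * E = z ^+ 4 by rewrite /o divfK// gt_eqF.
have z4w : z ^+ 4 < w0.+1%:R * E by rewrite -oE ltr_pM2r.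
have z5 : z ^+ 5 = z * z ^+ 4 by rewrite exprS.
split.
- apply/andP; split; last first.
    by apply: le_trans (ltW z4w) _; rewrite /E le_eqVlt; apply/orP; left; apply/eqP; field.
  have -> : 2 * w0.+1%:R * (p * (1 - p) * h ^+ 2 / 2) * (1 - z) ^+ 2 * (1 - 2 * z) =
      w0.+1%:R * E * (1 - z) by rewrite /E; field.
  have : w0.+1%:R * E <= z ^+ 4 + z * z ^+ 4.
    by rewrite -z5 wS mulrDl mul1r lerD// -?oE ?ler_pM2r//; lra.
  have : 0 <= z ^+ 4 by rewrite exprn_ge0// ltW.
  have : 0 <= z * z ^+ 4 by rewrite mulr_ge0// ?exprn_ge0// ltW.
  move: (z ^+ 4) (_ * E) => Z W; nra.
- have : 1 < w0.+1%:R * z; last by rewrite wS; lra.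
  have wz : z ^+ 4 < z ^+ 4 * (w0.+1%:R * z).
    apply: lt_le_trans z4w _.
    have -> : z ^+ 4 * (w0.+1%:R * z) = w0.+1%:R * z ^+ 5 by rewrite z5; ring.
    by rewrite ler_wpM2l//; lra.
  by rewrite -(ltr_pM2l (exprn_gt0 4 z0)) mulr1.
- by apply: le_trans (ltW z4w) _; rewrite ler_wpM2l.
Qed.

End ExponentialGain.

(** * Choice of the constants *)

Section MainGain.
Variable R : realType.

Lemma union_term_lt (n m : nat) (A r : R) : n%:R <= expR A ->
  m%:R * (A + m%:R / 2 * r) <= -1 -> n%:R ^+ m * expR (m%:R ^+ 2 / 2 * r) < 2^-1.
Proof.
move=> nA H; apply: (@le_lt_trans _ _ (expR (- 1))); last first.
  have := @expR_gt1Dx R 1; rewrite oner_eq0 => /(_ isT) e1.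
  by rewrite expRN ltf_pV2 ?posrE ?expR_gt0//; lra.
apply: (@le_trans _ _ (expR A ^+ m * expR (m%:R ^+ 2 / 2 * r))).
  by rewrite ler_wpM2r ?expR_ge0// lerXn2r ?nnegrE ?ler0n ?expR_ge0.
by rewrite -expRM_natl -expRD ler_expR; lra.
Qed.

Lemma card_groups_bounds (w0 l : nat) :
  let m : R := #|{: 'I_w0.+1 * 'I_(l %/ w0.+1)}|%:R in l%:R - w0.+1%:R < m <= l%:R.
Proof.
rewrite card_groups /= mulnC; apply/andP; split; last by rewrite ler_nat leq_trunc_div.
by rewrite ltrBlDr -natrD ltr_nat addnC -mulSn ltn_ceil.
Qed.

Lemma shift_bound (c p Th : R) : 0 < p < 2^-1 -> 0 < c -> c < (1 - p) ^+ 2 -> 0 < Th <= 8^-1 ->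
  `|- ((1 - p) * (1 - 2 * p) / 2) + (1 - p) / 6 * ((1 - p) ^+ 2 + c) * Th| <= 1.
Proof.
move=> /andP[p0 p1] c0 c1 /andP[T0 T1].
have q2 : (1 - p) ^+ 2 <= 1 by rewrite expr_le1//; lra.
have i1 : 0 <= (1 - p) * (1 - 2 * p) <= 1.
  by apply/andP; split; [rewrite mulr_ge0; lra|rewrite mulr_ile1; lra].
have i2 : 0 <= (1 - p) * ((1 - p) ^+ 2 + c) <= 2.
  apply/andP; split; first by rewrite mulr_ge0; lra.
  by rewrite -[leRHS]mul1r; apply: ler_pM; lra.
have i3 : 0 <= (1 - p) * ((1 - p) ^+ 2 + c) * Th <= 2 * 1.
  by apply/andP; split; [rewrite mulr_ge0; lra|apply: ler_pM; lra].
by rewrite ler_norml; lra.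
Qed.

(* [p0] is the critical density and [p0 + y * h ^+ 2] the density actually used:
   the shift equalises the second-order effects on the two colours, and the
   [Th]-linear part of [y] splits the third-order gain between them. *)
Definition gain_params (C p0 Th z h y eta : R) : Prop :=
  let p := p0 + y * h ^+ 2 in
  [/\ [/\ 0 < Th <= 8^-1, C * Th <= 8^-1, 0 < z <= 8^-1, 0 < h <= z ^+ 4 & 2 * h <= z ^+ 2],
      [/\ h ^+ 2 <= z ^+ 5, 0 < p < 1, `|p - p0| <= z & 0 < eta],
      h ^+ 2 * (y / p0 + ((1 - p0) ^+ 2 / 2 - p0 * (1 - p0) / 2
        - (1 - p0) ^+ 3 * Th / 3 + Th ^+ 2 + 20 * z)) <= - (2 * eta)
    & h ^+ 2 * (- (y / (1 - p0)) + (p0 ^+ 2 / 2 - p0 * (1 - p0) / 2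
        + p0 ^+ 3 * C * Th / 3 + 2 * C ^+ 2 * Th ^+ 2 + 20 * z)) <= - (2 * eta)].

Lemma exists_gain_params (C p0 : R) : 1 < C -> 0 < p0 < 2^-1 -> C * p0 ^+ 2 < (1 - p0) ^+ 2 ->
  exists Th z h y eta, gain_params C p0 Th z h y eta.
Proof.
move=> C1 p0b gp; have /andP[p00 p02] := p0b.
(* The net third-order gain, positive by [gain_beats_loss]: after the shift each colour gains at
   least [g * Th / 6]. *)
pose g := p0 * ((1 - p0) ^+ 2 - C * p0 ^+ 2).
have g0 : 0 < g by rewrite /g mulr_gt0// subr_gt0.
have p2 : 0 < p0 ^+ 2 by rewrite exprn_gt0.
have q2 : (1 - p0) ^+ 2 <= 1 by rewrite expr_le1//; lra.
have Cp0 : 0 < C * p0 ^+ 2 by rewrite mulr_gt0//; lra.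
have g1 : g <= 1 by rewrite /g -[leRHS]mulr1; apply: ler_pM; lra.
have C0 : 0 < C by lra.
(* Makes [2 * C ^+ 2 * Th ^+ 2] equal to [g * Th / 24]; below, [z] is chosen so that [20 * z] has
   this value too. *)
pose Th := g / (48 * C ^+ 2).
have CC : 1 <= C ^+ 2 by rewrite expr_ge1//; lra.
have C2 : 0 < C ^+ 2 by lra.
have ThE : Th * (48 * C ^+ 2) = g by rewrite /Th divfK// gt_eqF// mulr_gt0.
have Th0 : 0 < Th by rewrite /Th divr_gt0// mulr_gt0.
have CTh0 : 0 < C * Th by rewrite mulr_gt0.
have CTh : C * Th <= 48^-1.
  have : (C * Th) * 1 <= (C * Th) * C by rewrite ler_pM2l// ltW.
  lra.
have ThC : Th <= C * Th by rewrite -[leLHS]mul1r ler_pM2r// ltW.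
have ThT : 48 * C ^+ 2 * Th ^+ 2 = g * Th by rewrite -ThE; ring.
pose z := g * Th / 20 / 24.
have gT0 : 0 < g * Th by rewrite mulr_gt0.
have gT1 : g * Th <= 48^-1 by apply: le_trans (le_trans ThC CTh); rewrite -[leRHS]mul1r ler_pM2r.
have z0 : 0 < z by rewrite /z !divr_gt0.
have z20 : 20 * z = g * Th / 24 by rewrite /z; field.
have z8 : z <= 8^-1 by lra.
have z4p : 0 < z ^+ 4 by rewrite exprn_gt0.
pose h := p0 * z ^+ 4 / 2.
have h0 : 0 < h by rewrite /h divr_gt0// mulr_gt0.
have hz4 : h <= z ^+ 4 / 4.
  have : p0 * z ^+ 4 <= 2^-1 * z ^+ 4 by rewrite ler_pM2r// ltW.
  by rewrite /h; lra.
have z21 : z ^+ 2 <= 1 by rewrite expr_le1//; lra.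
have z2p : 0 < z ^+ 2 by rewrite exprn_gt0.
have z42 : z ^+ 4 <= z ^+ 2.
  have -> : z ^+ 4 = z ^+ 2 * z ^+ 2 by ring.
  by rewrite -[leRHS]mulr1 ler_pM2l.
have z2z : z ^+ 2 <= z by rewrite expr2 -[leRHS]mulr1 ler_pM2l//; lra.
have hz2 : 2 * h <= z ^+ 2 by lra.
have h1 : h <= 1 by lra.
have h2p : 0 < h ^+ 2 by rewrite exprn_gt0.
have hz5 : h ^+ 2 <= z ^+ 5.
  have -> : z ^+ 5 = z ^+ 4 * z by rewrite exprSr.
  by rewrite expr2; apply: ler_pM; lra.
have hh : h ^+ 2 <= p0 * z / 2.
  have hp : h <= p0 * z / 2.
    have : p0 * z ^+ 4 <= p0 * z by rewrite ler_pM2l//; lra.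
    by rewrite /h; lra.
  by apply: le_trans hp; rewrite expr2 -[leRHS]mulr1 ler_pM2l.
(* [I = y / p0]. Its first term cancels the second-order terms of both colours. Its second term is
   the mean of the red gain and the blue loss, so that both colours keep half of the difference. *)
pose I := - ((1 - p0) * (1 - 2 * p0) / 2) + (1 - p0) / 6 * ((1 - p0) ^+ 2 + C * p0 ^+ 2) * Th.
have I1 : `|I| <= 1 by apply: shift_bound => //; lra.
pose y := p0 * I.
pose p := p0 + y * h ^+ 2.
have dp : `|p - p0| <= p0 * z / 2.
  rewrite /p addrAC subrr add0r normrM (gtr0_norm h2p) -[leRHS]mul1r ler_pM ?normr_ge0//; first exact: ltW.
  by rewrite /y normrM (gtr0_norm p00) mulr_ile1 ?normr_ge0//; lra.
have p0z : p0 * z <= p0 / 2 by rewrite ler_pM2l//; lra.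
have p0z' : p0 * z <= z by rewrite -[leRHS]mul1r ler_pM2r//; lra.
have dpz : `|p - p0| <= z by lra.
have p01 : 0 < p < 1 by move: dp; rewrite ler_norml; lra.
have /andP[p_0 p_1] := p01.
(* Of the gain [g * Th / 6] at most [g * Th / 12] is lost to errors, and [g * Th / 24] is claimed as
   [2 * eta / h ^+ 2]. *)
pose eta := h ^+ 2 * (g * Th / 48).
have eta0 : 0 < eta by rewrite /eta mulr_gt0// divr_gt0.
have gE : g = p0 * ((1 - p0) ^+ 2 - C * p0 ^+ 2) by [].
have ThTh : Th ^+ 2 <= g * Th / 48.
  have : 1 * Th ^+ 2 <= C ^+ 2 * Th ^+ 2 by rewrite ler_wpM2r// sqr_ge0.
  lra.
have marg1 : h ^+ 2 * (y / p0 + ((1 - p0) ^+ 2 / 2 - p0 * (1 - p0) / 2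
    - (1 - p0) ^+ 3 * Th / 3 + Th ^+ 2 + 20 * z)) <= - (2 * eta).
  have -> : - (2 * eta) = h ^+ 2 * - (g * Th / 24) by rewrite /eta; field.
  rewrite ler_pM2l//.
  have -> : y / p0 = I by rewrite /y mulrAC divff ?mul1r// gt_eqF.
  have : p0 * (((1 - p0) ^+ 2 - C * p0 ^+ 2) * Th) <=
      (1 - p0) * (((1 - p0) ^+ 2 - C * p0 ^+ 2) * Th).
    by rewrite ler_pM2r; [lra|rewrite mulr_gt0// subr_gt0].
  rewrite z20; move: ThTh gT0; rewrite gE /I; lra.
have marg2 : h ^+ 2 * (- (y / (1 - p0)) + (p0 ^+ 2 / 2 - p0 * (1 - p0) / 2
    + p0 ^+ 3 * C * Th / 3 + 2 * C ^+ 2 * Th ^+ 2 + 20 * z)) <= - (2 * eta).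
  have -> : - (2 * eta) = h ^+ 2 * - (g * Th / 24) by rewrite /eta; field.
  rewrite ler_pM2l//.
  have -> : y / (1 - p0) = - (p0 * (1 - 2 * p0) / 2) +
      p0 / 6 * ((1 - p0) ^+ 2 + C * p0 ^+ 2) * Th.
    by rewrite /y /I; field; rewrite gt_eqF; lra.
  have -> : 2 * C ^+ 2 * Th ^+ 2 = g * Th / 24 by rewrite -ThT; field.
  rewrite z20 gE; move: gT0; rewrite gE; lra.
exists Th, z, h, y, eta; split => //; split => //; try by apply/andP; split=> //; lra.
- lra.
Qed.

End MainGain.

(** * Dimension, group sizes and the final union bound *)

Section Assembly.
Variable R : realType.

Lemma le_of_sum3_lt (a b c l : R) : 0 < a -> 0 < b -> 0 < c -> a + b + c < l ->
  [/\ a <= l, b <= l, c <= l & 0 < l].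
Proof. by move=> a0 b0 c0 H; split; lra. Qed.

Lemma large_group (z a b eta m w lr : R) : 0 < z -> 0 < a -> 0 < b -> 0 < eta ->
  (w + 2) + (2 / z + (a + b) / eta) <= lr -> lr - 1 - w < m ->
  [/\ 1 <= m, 2 / m <= z, a / m <= eta & b / m <= eta].
Proof.
move=> z0 a0 b0 eta0 H mw.
have i1 : 0 < 2 / z by rewrite divr_gt0.
have i2 : 0 < a / eta by rewrite divr_gt0.
have i3 : 0 < b / eta by rewrite divr_gt0.
have m0 : 0 < m by lra.
by split; [lra|..]; rewrite ler_pdivrMr// mulrC -ler_pdivrMr//; lra.
Qed.

(** For [m] close to [lr] the second factor is near [- 3 / 8 * eta * lr], and the hypothesis on [lr]
    pays for the up to [w] vertices lost by rounding. *)
Lemma red_exponent (L0 eta lr m w : R) : 0 <= L0 -> 0 < eta -> 0 <= w -> lr - w < m -> 1 <= m ->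
  8 * ((w + 1) * (L0 + eta) + 1) <= lr * eta ->
  m * (lr * (L0 / 2 + eta / 8) + m / 2 * (- L0 - eta)) <= -1.
Proof.
move=> L00 eta0 w0 mw m1 H.
have h1 : 0 <= (m - (lr - w)) * (L0 + eta) by rewrite mulr_ge0; lra.
have h2 : 0 <= w * (L0 + eta) by rewrite mulr_ge0; lra.
set X := lr * _ + _; have X1 : X <= -1 by rewrite /X; lra.
have : 0 <= (m - 1) * (- X) by rewrite mulr_ge0; lra.
lra.
Qed.

Lemma blue_exponent (C M eta lr m w : R) : 1 < C -> 0 <= M -> 0 < eta -> 0 <= lr -> 0 <= w ->
  C * lr - 1 - w < m -> 1 <= m -> 8 * ((w + 1) * (C * M + eta) + 1) <= lr * eta ->
  m * (lr * (C * M / 2 + eta / 8) + m / 2 * (- M - eta)) <= -1.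
Proof.
move=> C1 M0 eta0 lr0 w0 mw m1 H.
have h1 : 0 <= (m - (C * lr - 1 - w)) * (M + eta) by rewrite mulr_ge0; lra.
have CM : 0 <= (C - 1) * M by rewrite mulr_ge0; lra.
have h2 : 0 <= (w + 1) * ((C - 1) * M) by rewrite mulr_ge0; lra.
have h4 : 0 <= (w + 1) * (M + eta) by rewrite mulr_ge0; lra.
have h3 : 0 <= lr * eta * (C - 1) by rewrite !mulr_ge0; lra.
set X := lr * _ + _; have X1 : X <= -1 by rewrite /X; lra.
have : 0 <= (m - 1) * (- X) by rewrite mulr_ge0; lra.
lra.
Qed.

Lemma red_slope (q h z m D lr w Th : R) : 0 < q < 1 -> 0 < h -> 0 < z <= 8^-1 -> 0 < Th ->
  0 < D -> h * lr < D * Th -> D * Th <= h * lr + Th -> lr - w < m <= lr ->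
  h * w + Th <= z * (h * lr) -> q * Th * (1 - z) <= q * h / (1 - z) * m / D <= 2 * Th.
Proof.
move=> /andP[q0 q1] h0 /andP[z0 z8] T0 D0 D1 D2 /andP[m1 m2] H.
have z1 : 0 < 1 - z by lra.
have hm : h * (lr - w) <= h * m by rewrite ler_pM2l// ltW.
have hm2 : h * m <= h * lr by rewrite ler_pM2l.
have DT : 0 < D * Th by rewrite mulr_gt0.
have zT : 0 < z * Th by rewrite mulr_gt0.
have zDT : z * (h * lr) <= z * (D * Th) by rewrite ler_pM2l// ltW.
have -> : q * h / (1 - z) * m / D = q * (h * m) / ((1 - z) * D).
  by field; rewrite !gt_eqF.
have zD : 0 < (1 - z) * D by rewrite mulr_gt0.
apply/andP; split.
  rewrite ler_pdivlMr// -mulrA -[leLHS]mulrA ler_pM2l//.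
  have hm0 : D * Th * (1 - z) <= h * m by lra.
  have : 0 <= D * Th * (1 - z) * z by rewrite !mulr_ge0; lra.
  lra.
rewrite ler_pdivrMr//.
have : q * (h * m) <= D * Th.
  have [hm0|hm0] := leP 0 (h * m); last by nra.
  by apply: (@le_trans _ _ (1 * (h * m))); [rewrite ler_wpM2r//; lra|lra].
have : 0 <= D * Th * (1 - 2 * z) by rewrite mulr_ge0; lra.
lra.
Qed.

Lemma red_step_small (q h z D : R) : 0 < q < 1 -> 0 < h -> 0 < z <= 8^-1 ->
  2 * h <= z ^+ 2 -> 1 <= D -> q * h / (1 - z) / (2 * D) <= 4^-1.
Proof.
move=> /andP[q0 q1] h0 /andP[z0 z8] hz D1.
have zz : z ^+ 2 <= z * 1 by rewrite expr2 ler_pM2l//; lra.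
rewrite ler_pdivrMr ?mulr_gt0//; [|lra..]; rewrite ler_pdivrMr; last lra.
have qh : q * h <= 1 * 8^-1 by apply: ler_pM; lra.
have : 0 <= (D - 1) * (1 - z) by rewrite mulr_ge0; lra.
lra.
Qed.

Lemma blue_slope (C p h z m D lr Th : R) : 0 < C -> 0 < p < 1 -> 0 < h -> 0 < z <= 8^-1 ->
  0 < Th -> C * Th <= 8^-1 -> 0 < D -> h * lr < D * Th -> m <= C * lr ->
  let th := p * h / (1 - z) * m / D in th <= p * Th * C / (1 - z) /\ th <= 2^-1.
Proof.
move=> C0 /andP[p0 p1] h0 /andP[z0 z8] T0 CT D0 D1 mC th.
have z1 : 0 < 1 - z by lra.
have thC : th <= p * Th * C / (1 - z).
  have -> : th = p * (h * m / D) / (1 - z) by rewrite /th; ring.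
  rewrite ler_pM2r ?invr_gt0// -[leRHS]mulrA ler_pM2l// ler_pdivrMr//.
  have s1 : h * m <= h * (C * lr) by rewrite ler_pM2l.
  have s2 : C * (h * lr) <= C * (D * Th) by rewrite ler_pM2l// ltW.
  lra.
split => //; apply: le_trans thC _; rewrite ler_pdivrMr//.
have CT0 : 0 < C * Th by rewrite mulr_gt0.
have : p * (C * Th) <= 1 * 8^-1 by apply: ler_pM; lra.
lra.
Qed.

(** The groups are numerous: [w * h >= 1]. Hence [b] is at most about [C * h * lr], while [D]
    exceeds [h * lr / Th], and [C * Th] is small. *)
Lemma group_le_dim (w0 b D : nat) (C h z Th lr : R) : 0 < h <= z ^+ 4 -> C * Th <= 8^-1 ->
  0 <= lr -> 0 < Th -> z ^+ 4 <= w0.+1%:R * h ^+ 2 -> h * lr < D%:R * Th ->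
  w0.+1%:R * b%:R <= C * lr -> b%:R <= D%:R :> R.
Proof.
move=> /andP[h0 hz] CT lr0 T0 zw D1 wb.
have wp : 0 < w0.+1%:R :> R by rewrite ltr0n.
have hw : 1 <= w0.+1%:R * h.
  have : 1 * h <= w0.+1%:R * h * h by rewrite mul1r -mulrA -expr2 (le_trans hz).
  by rewrite ler_pM2r.
rewrite -(ler_pM2l (mulr_gt0 wp T0)).
have s1 : Th * (w0.+1%:R * b%:R) <= Th * (C * lr) by rewrite ler_pM2l.
have s2 : w0.+1%:R * (h * lr) <= w0.+1%:R * (D%:R * Th) by rewrite ler_pM2l// ltW.
have s3 : 0 <= lr * (w0.+1%:R * h - C * Th) by rewrite mulr_ge0; lra.
lra.
Qed.

Lemma exponential_gain (C p0 : R) : 1 < C -> 0 < p0 < 2^-1 -> C = ln p0 / ln (1 - p0) ->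
  exists2 gam : R, 0 < gam & exists L : nat, forall l : nat, (L <= l)%N -> forall n : nat,
    n%:R <= expR (l%:R * (- ln p0 / 2 + gam)) -> ~ ramsey_prop l (Num.truncn (C * l%:R)) n.
Proof.
move=> C1 p0b CE.
have [Th [z [h [y [eta]]]]] := exists_gain_params R C p0 C1 p0b (gain_beats_loss R C p0 p0b CE).
rewrite /gain_params; set p := p0 + y * h ^+ 2.
move=> [[Thb CT zb hb hz2] [hz5 pb dp eta0] marg1 marg2].
have /andP[p00 p02] := p0b; have /andP[Th0 Th8] := Thb; have /andP[z0 z8] := zb.
have /andP[h0 hz4] := hb; have /andP[p_0 p_1] := pb.
have p001 : 0 < p0 < 1 by rewrite p00/=; lra.
have z4b : 0 < z <= 4^-1 by rewrite z0/=; lra.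
have prm : logistic_params R p h z by [].
have [w0 [hw wz zw]] := exists_rounds R p h z pb h0 z4b hz5.
set w : R := w0.+1%:R in hw wz zw.
have w0' : 0 < w by rewrite ltr0n.
set L0 := - ln p0; have L00 : 0 < L0 by rewrite oppr_gt0 ln_lt0.
have lq0 : ln (1 - p0) < 0 by rewrite ln_lt0; lra.
(* The critical equation makes the leading exponents for red and blue agree, so that one bound on
   [n] serves both colours. *)
have L0C : L0 = C * - ln (1 - p0) by rewrite CE mulrN divfK ?lt_eqF.
have q01 : 0 < 1 - p < 1 by lra.
have lp : 0 < - ln p by rewrite oppr_gt0 ln_lt0.
have lq : 0 < - ln (1 - p) by rewrite oppr_gt0 ln_lt0.
(* Thresholds for [l]: [X1] makes the cliques large enough for [large_group], [X2] serves
   [red_slope], and [X3] the two exponent estimates. *)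
pose X1 := (w + 2) + (2 / z + (- ln p - ln (1 - p)) / eta).
pose X2 := (h * w + Th) / (h * z).
pose X3 := 8 * ((w + 1) * (L0 + eta) + 1) / eta.
have X10 : 0 < 2 / z + (- ln p - ln (1 - p)) / eta by rewrite addr_gt0// divr_gt0// addr_gt0.
have hz0 : 0 < h * z by rewrite mulr_gt0.
have X20 : 0 < X2 by rewrite divr_gt0// addr_gt0// mulr_gt0.
have X30 : 0 < X3.
  by rewrite divr_gt0// mulr_gt0// addr_gt0// mulr_gt0// addr_gt0.
exists (eta / 8); first by rewrite divr_gt0.
exists (Num.truncn (X1 + X2 + X3)).+1 => l Ll n nA.
set lr : R := l%:R in nA *.
have lX : X1 + X2 + X3 < lr by apply: lt_le_trans (truncnS_gt _) _; rewrite ler_nat.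
have X1p : 0 < X1 by rewrite addr_gt0// addr_gt0.
have [lX1 lX2 lX3 lr0] := le_of_sum3_lt _ _ _ _ X1p X20 X30 lX.
have {}lX2 : h * w + Th <= z * (h * lr) 
  by move: lX2; rewrite ler_pdivrMr// (_ : z * (h * lr) = lr * (h * z))//; ring.
have {}lX3 : 8 * ((w + 1) * (L0 + eta) + 1) <= lr * eta by move: lX3; rewrite ler_pdivrMr.
set k := Num.truncn (C * lr).
have Clr : lr <= C * lr by rewrite -[leLHS]mul1r ler_pM2r// ltW.
have Clr0 : 0 <= C * lr by lra.
have /andP[k1 k2] := truncn_itv Clr0; rewrite -/k -natr1 in k1 k2.
(* With this dimension [Th] approximates [h * l / D], the triangle parameter without its colour
   factor. *)
pose D := (Num.truncn (h * lr / Th)).+1.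
have hT0 : 0 <= h * lr / Th by rewrite divr_ge0// ?mulr_ge0// ltW.
have /andP[D2 D1] := truncn_itv hT0.
have Dp : 0 < D%:R :> R by rewrite ltr0n.
have {}D1 : h * lr < D%:R * Th by rewrite -ltr_pdivrMr.
have {}D2 : D%:R * Th <= h * lr + Th.
  by rewrite /D -natr1 mulrDl mul1r lerD2r -ler_pdivlMr.
have large (m : R) : lr - 1 - w < m ->
    [/\ 1 <= m, 2 / m <= z, - ln p / m <= eta & - ln (1 - p) / m <= eta].
  by move=> mw; exact: (large_group _ _ _ _ _ _ _ z0 lp lq eta0 lX1 mw).
(* The clique sizes are rounded down to multiples of the number of groups; [ramsey_prop_sub] undoes
   this at the end. *)
pose V1 := ('I_w0.+1 * 'I_(l %/ w0.+1))%type.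
pose V2 := ('I_w0.+1 * 'I_(k %/ w0.+1))%type.
set m1 : R := #|{: V1}|%:R; set m2 : R := #|{: V2}|%:R.
have /andP[m1a m1b] : lr - w < m1 <= lr := card_groups_bounds R w0 l.
have /andP[m2a m2b] : k%:R - w < m2 <= k%:R := card_groups_bounds R w0 k.
have [m11 m1z lp1 _] : [/\ 1 <= m1, 2 / m1 <= z, - ln p / m1 <= eta & - ln (1 - p) / m1 <= eta].
  by apply: large; lra.
have m2c : C * lr - 1 - w < m2 by lra.
have [m21 _ _ lq2] : [/\ 1 <= m2, 2 / m2 <= z, - ln p / m2 <= eta & - ln (1 - p) / m2 <= eta].
  by apply: large; lra.
have rpar (b : nat) : 1 <= #|{: 'I_w0.+1 * 'I_b}|%:R :> R ->
    #|{: 'I_w0.+1 * 'I_b}|%:R <= C * lr -> round_params R w0 b D p h z.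
  rewrite card_groups => m_1 mC; rewrite natrM in mC.
  have b0 : (0 < b)%N by move: m_1; rewrite ler1n muln_gt0 => /andP[].
  have bD := group_le_dim w0 b D C h z Th lr hb CT (ltW lr0) Th0 zw D1 mC.
  split => //.
  have -> : z ^+ 2 * b%:R ^+ 2 / D%:R ^+ 2 = z * (z * (b%:R / D%:R) ^+ 2).
    by field; rewrite gt_eqF.
  have zle : z <= 1 by apply: le_trans z8 _; rewrite invf_le1// ler1n.
  rewrite -[leRHS]mulr1 ler_pM2l// mulr_ile1 ?sqr_ge0 ?(ltW z0)//.
  by rewrite expr_le1 ?divr_ge0// ler_pdivrMr// mul1r.
have rp1 : round_params R w0 (l %/ w0.+1) D p h z by apply: rpar => //; lra.
have rp2 : round_params R w0 (k %/ w0.+1) D p h z by apply: rpar => //; lra.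
have pE : p = p0 + y * h ^+ 2 by [].
have B1 := red_clique_bound R w0 (l %/ w0.+1) D p0 p h z Th eta y rp1 z8 p001 pE dp Thb.
have B2 := blue_clique_bound R w0 (k %/ w0.+1) D C p0 p h z Th eta y rp2 z8 C1 p001 pE dp Th0 CT.
have sl := red_slope (1 - p) h z m1 D%:R lr w Th q01 h0 zb Th0 Dp D1 D2.
have {}B1 : bitavg R (V1 * 'I_(D ^ 2))%type (fun x => expR ((\sum_u \sum_(v | v != u)
    ln (redw R p h (corr R V1 D x u v))) / 2)) <= expR (m1 ^+ 2 / 2 * (ln p0 - eta)).
  apply: B1 => //; first by apply: sl => //; rewrite m1a.
  by apply: red_step_small; rewrite ?ler1n.
have m2C : m2 <= C * lr by exact: le_trans m2b k1.
have [CTh CTh2] := blue_slope C p h z m2 D%:R lr Th (lt_trans ltr01 C1) pb h0 zb Th0 CT Dp D1 m2C.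
have {}B2 : bitavg R (V2 * 'I_(D ^ 2))%type (fun x => expR ((\sum_u \sum_(v | v != u)
    ln (bluew R p h (corr R V2 D x u v))) / 2)) <= expR (m2 ^+ 2 / 2 * (ln (1 - p0) - eta)).
  exact: B2.
have nA' : n%:R <= expR (lr * (L0 / 2 + eta / 8)) by [].
have e1 : m1 * (lr * (L0 / 2 + eta / 8) + m1 / 2 * (ln p0 - eta)) <= -1.
  rewrite (_ : ln p0 = - L0); last by rewrite /L0 opprK.
  exact: (red_exponent _ _ _ _ _ (ltW L00) eta0 (ltW w0') m1a m11 lX3).
have e2 : m2 * (lr * (L0 / 2 + eta / 8) + m2 / 2 * (ln (1 - p0) - eta)) <= -1.
  have M0 : 0 <= - ln (1 - p0) by rewrite oppr_ge0 ltW.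
  have := blue_exponent C _ eta lr m2 w C1 M0 eta0 (ltW lr0) (ltW w0') m2c m21.
  by rewrite opprK -L0C; apply.
have u1 := union_term_lt R n #|{: V1}| _ _ nA' e1.
have u2 := union_term_lt R n #|{: V2}| _ _ nA' e2.
have nr : ~ ramsey_prop #|{: V1}| #|{: V2}| n.
  apply: (not_ramsey_avg R n D V1 V2 p h _ _ pb B1 B2).
  have half2 : 2^-1 + 2^-1 = 1 :> R by field.
  by have := ltrD u1 u2; rewrite half2.
move=> Hr; apply: nr; apply: ramsey_prop_sub Hr; rewrite -(ler_nat R).
- exact: m1b.
- exact: m2b.
Qed.

End Assembly.

Theorem theorem1p1 (R : realType) (C : R) (hC : 1 < C) :
  (exists! p : R, 0 < p < 2^-1 /\ C = ln p / ln (1 - p)) /\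
  (forall p : R, 0 < p < 2^-1 -> C = ln p / ln (1 - p) ->
   exists eps : R, 0 < eps /\
   exists L : nat, forall l : nat, (L <= l)%N ->
     ((Num.sqrt p)^-1 + eps) ^+ l <= (ramsey l (Num.truncn (C * l%:R)))%:R).
Proof.
split; first exact: exists_unique_root.
move=> p pb CE; have [gam gam0 [L HL]] := exponential_gain R C p hC pb CE.
have /andP[p0 _] := pb.
have sqrtE : (Num.sqrt p)^-1 = expR (- ln p / 2).
  rewrite mulNr expRN; congr _^-1.
  have {1}-> : p = expR (ln p / 2) ^+ 2 by rewrite -expRM_natl mulrC divfK ?lnK ?posrE.
  by rewrite sqrtr_sqr ger0_norm// expR_ge0.
(* With this choice the base in the claim becomes [expR (- ln p / 2 + gam)]. *)
exists (expR (- ln p / 2 + gam) - expR (- ln p / 2)); split.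
  by rewrite subr_gt0 ltr_expR ltrDl.
exists L => l Ll; rewrite sqrtE subrKC -expRM_natl.
set X := expR _.
have X0 : 0 <= X by exact: expR_ge0.
(* The integer part [n] of [X] is not Ramsey, so the Ramsey number is at least [n + 1], which
   exceeds [X]. *)
have /andP[nX Xn] := truncn_itv X0.
apply: le_trans (ltW Xn) _; rewrite ler_nat.
exact: not_ramsey_prop_ltn (HL l Ll _ nX).
Qed.
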